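(* Let $(R,+,\cdot)$ be a finite semiring whose additive semigroup has a neutral element. Then $(R,+,\cdot)$ is simple if and only if one of the following holds: (1) $|R|\le 2$; (2) $(R,+,\cdot)\cong(\mathrm{Mat}_n(\mathbb{F}_q),+,\cdot)$ for some finite field $\mathbb{F}_q$ and some $n\ge1$; (3) $(R,+,\cdot)$ is a ring of prime order with zero multiplication; (4) $(R,+,\cdot)$ is isomorphic to a subsemiring $S$ of $(\mathrm{Res}(\mathbf{L}),\vee,\circ)$ for a finite lattice $\mathbf{L}$ with $e_{a,b}\in S$ for all $a,b\in L$; (5) $(R,+,\cdot)$ is isomorphic to a subsemiring $S$ of $(\mathrm{Res}_1(\mathbf{L}),\vee,\circ)$ for a finite lattice $\mathbf{L}$ with more than two elements whose greatest element $1$ is join-irreducible, where $S$ satisfies: $f_{a,0}\in S$ for all $a\in L\setminus\{1\}$; every $f\in S$ satisfies $f_{a,0}\le f$ for some $a\in L\setminus\{1\}$; for all $a\in L\setminus\{0,1\}$, $b\in L$ there is $f\in S$ with $f(a)=b$; (6) $(R,+,\cdot)$ is isomorphic to a subsemiring $S$ of $(\mathrm{JM}(\mathbf{L}),\vee,\circ)$ for a finite nontrivial lattice $\mathbf{L}$, where $S$ satisfies: $k_a\in S$ for all $a\in L$; every $f\in S$ satisfies $k_a\le f$ for some $a\in L$; for all $a\in L$, $b\in L\setminus\{1\}$ there is $f\in S$ with $f(x)=b$ for $x\le a$ and $f(x)>b$ otherwise; (7) $(R,+,\cdot)$ is isomorphic to a subsemiring $S$ of $(\mathrm{JM}_1(\mathbf{L}),\vee,\circ)$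 for a finite nontrivial lattice $\mathbf{L}$ whose greatest element $1$ is join-irreducible, where $S$ satisfies: $f_{a,b}\in S$ for all $a\in L\setminus\{1\}$, $b\in L$; every $f\in S$ satisfies $f_{a,b}\le f$ for some $a\in L\setminus\{1\}$, $b\in L$.
   Context: A semiring is a nonempty set with a commutative semigroup operation $+$ and a semigroup operation $\cdot$ satisfying both distributive laws (no neutral elements required); it is simple if its only congruences (equivalences compatible with $+$ and with left and right multiplication) are the identity and the full relation. For a finite lattice $\mathbf{L}=(L,\le)$ with least element $0$ and greatest element $1$: $\mathrm{JM}(\mathbf{L})$ is the set of maps $L\to L$ preserving binary joins; $\mathrm{JM}_1(\mathbf{L})=\{f\in\mathrm{JM}(\mathbf{L}): f(1)=1\}$; $\mathrm{Res}(\mathbf{L})=\{f\in\mathrm{JM}(\mathbf{L}):f(0)=0\}$; $\mathrm{Res}_1(\mathbf{L})=\{f\in\mathrm{Res}(\mathbf{L}):f(1)=1\}$; all are semirings under pointwise join $\vee$ and composition $\circ$, ordered pointwise. $e_{a,b}(x)=0$ if $x\le a$, $b$ otherwise; $f_{a,b}(x)=b$ if $x\le a$, $1$ otherwise; $k_a$ is the constant map with value $a$. The element $1$ is join-irreducible if $1\ne a\vee b$ for all $a,b\in L\setminus\{1\}$. *)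

(* Defs.v *)
From HB Require Import structures.
From mathcomp Require Import all_boot all_order all_algebra all_field.
Set Implicit Arguments. Unset Strict Implicit. Unset Printing Implicit Defensive.
Import Order.Theory.

Section Semiring.
Variable R : Type.
Variables (add mul : R -> R -> R).

Definition is_semiring : Prop :=
  [/\ (forall x y w, add x (add y w) = add (add x y) w),
      (forall x y, add x y = add y x),
      (forall x y w, mul x (mul y w) = mul (mul x y) w),
      (forall x y w, mul x (add y w) = add (mul x y) (mul x w)) &
      (forall x y w, mul (add x y) w = add (mul x w) (mul y w))].

Definition congruence (r : R -> R -> Prop) : Prop :=
  [/\ (forall x, r x x), (forall x y, r x y -> r y x),
      (forall x y w, r x y -> r y w -> r x w),
      (forall x y w, r x y -> r (add x w) (add y w)) &
      (forall x y w, r x y -> r (mul w x) (mul w y) /\ r (mul x w) (mul y w))].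

Definition simple_semiring : Prop :=
  forall r, congruence r -> (forall x y, r x y <-> x = y) \/ (forall x y, r x y).

Definition semiring_iso (T : Type) (addT mulT : T -> T -> T) : Prop :=
  exists phi : R -> T, bijective phi /\
    forall x y, phi (add x y) = addT (phi x) (phi y) /\
                phi (mul x y) = mulT (phi x) (phi y).
End Semiring.

Section LatticeMaps.
Context {disp : Order.disp_t} {L : finTBLatticeType disp}.
Local Open Scope order_scope.

Definition fjoin (f g : {ffun L -> L}) : {ffun L -> L} := [ffun x => f x `|` g x].
Definition fcomp (f g : {ffun L -> L}) : {ffun L -> L} := [ffun x => f (g x)].
Definition fle (f g : {ffun L -> L}) : Prop := forall x, f x <= g x.

Definition is_JM (f : {ffun L -> L}) : Prop := forall x y, f (x `|` y) = f x `|` f y.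
Definition is_JM1 (f : {ffun L -> L}) : Prop := is_JM f /\ f \top = \top.
Definition is_Res (f : {ffun L -> L}) : Prop := is_JM f /\ f \bot = \bot.
Definition is_Res1 (f : {ffun L -> L}) : Prop := is_Res f /\ f \top = \top.

Definition e_map (a b : L) : {ffun L -> L} := [ffun x => if x <= a then \bot else b].
Definition f_map (a b : L) : {ffun L -> L} := [ffun x => if x <= a then b else \top].
Definition k_map (a : L) : {ffun L -> L} := [ffun _ => a].

Definition top_join_irreducible : Prop :=
  forall a b : L, a != \top -> b != \top -> a `|` b != \top.

Definition subsemiring (P : {ffun L -> L} -> Prop) (S : {set {ffun L -> L}}) : Prop :=
  [/\ S != set0, (forall f, f \in S -> P f),
      (forall f g, f \in S -> g \in S -> fjoin f g \in S) &
      (forall f g, f \in S -> g \in S -> fcomp f g \in S)].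

Definition iso_to_maps (R : Type) (add mul : R -> R -> R) (S : {set {ffun L -> L}}) : Prop :=
  exists phi : R -> {ffun L -> L},
    [/\ injective phi, (forall x, phi x \in S),
        (forall f, f \in S -> exists x, phi x = f) &
        (forall x y, phi (add x y) = fjoin (phi x) (phi y) /\
                     phi (mul x y) = fcomp (phi x) (phi y))].
End LatticeMaps.

(* Main.v *)
Require Import Defs.
From HB Require Import structures.
From Stdlib Require Import Classical.
From mathcomp Require Import all_boot all_order all_fingroup all_solvable.
From mathcomp Require Import all_algebra all_field.
Set Implicit Arguments.
Unset Strict Implicit.
Unset Printing Implicit Defensive.
Import Order.Theory GRing.Theory.
Local Open Scope order_scope.

(** If [R] is simple with more than two elements, the congruence of archimedean
components of [(R, +)] is trivial or full, so [+] is idempotent or a group law.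

Group case: with zero multiplication every subgroup is an ideal, so the order is
prime; otherwise [R] acts faithfully and irreducibly on a minimal left ideal [V],
its commutant is a finite skew field, hence a field [F] (Schur, Wedderburn), and
Jacobson density gives all of [End_F V].

Idempotent case: write [0] for the neutral element, i.e. the least element.
Testing simplicity on suitable congruences gives [0 * 0 = 0], that multiplication
is faithful on both sides, and that [R] is faithful on [R * 0] unless [R * 0 = 0]
(dually for [0 * R]).  The lattice is then
- the minimal left ideal modulo equality of annihilators, if [0] is absorbing;
- the ideals of [0 * R] under reverse inclusion, if only [R * 0 = 0];
- [R * 0] otherwise, acted on by constants if [0 * R = 0]; if neither holds, the
  top of [R] is absorbing and [0 * R * 0 = {0, 1}], so that the products
  [(r * 0) * (0 * s)] act as the maps [f_{a,b}].
In each case the required maps are the largest elements of annihilator-like left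
ideals, and separation of points is again a congruence argument.

Conversely, composing two congruent maps [f], [g] with [f x] not below [g x] with
the given maps makes the least and the greatest map congruent. *)

(** * Congruences generated by one pair, and minimal left ideals *)

Lemma simple_by_contra (R : Type) (add mul : R -> R -> R) :
  (forall r, congruence add mul r -> forall x y, r x y -> x <> y -> forall u v, r u v) ->
  simple_semiring add mul.
Proof.
move=> H r cr; have [rxx _ _ _ _] := cr.
have [rE|/not_all_ex_not[x /not_all_ex_not[y nrxy]]] := classic (forall x y, r x y -> x = y).
  by left=> x y; split=> [/rE|-> //].
by have [rxy xy] := imply_to_and _ _ nrxy; right; apply: H cr _ _ rxy xy.
Qed.

(** Take [x] other than [z] whose orbit [R x] has least size. If [r x] is not [z], its orbit lies
    inside that of [x], and minimality makes the two equal. With [z] the neutral element, this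
    serves rings and semirings alike. *)
Lemma exists_minimal_left_ideal (R : finType) (mul : R -> R -> R) (z x1 : R) :
  associative mul -> x1 != z ->
  exists2 x, x != z &
    forall r, mul r x != z -> forall s, exists t, mul s x = mul t (mul r x).
Proof.
move=> mA x1z; pose orb x := [set mul r x | r in R].
case: (arg_minnP (P := fun x => x != z) (fun x => #|orb x|) x1z) => x xz xmin.
exists x => // r rxz s.
have sub : orb (mul r x) \subset orb x.
  by apply/subsetP => _ /imsetP[t _ ->]; rewrite mA imset_f.
have /eqP e : orb (mul r x) == orb x by rewrite eqEcard sub xmin.
have /imsetP[t _ ->] : mul s x \in orb (mul r x) by rewrite e imset_f.
by exists t.
Qed.

(** * Lattices from finite semilattices *)

Section SemilatticeToLattice.
Variables (T : finType) (j : T -> T -> T) (b : T).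
Hypotheses (jA : associative j) (jC : commutative j) (jxx : idempotent_op j).
Hypothesis j0x : left_id b j.

Let le x y := j x y == y.
Let sup (A : {pred T}) := \big[j/b]_(x in A) x.

Fact semilattice_le_refl : reflexive le.
Proof. by move=> x; rewrite /le jxx. Qed.

Fact semilattice_le_anti : antisymmetric le.
Proof. by move=> x y /andP[/eqP xy /eqP yx]; rewrite -xy jC yx. Qed.

Fact semilattice_le_trans : transitive le.
Proof. by move=> y x w /eqP xy /eqP yw; rewrite /le -yw jA xy. Qed.

Fact semilattice_join_lub x y w : le (j x y) w = le x w && le y w.
Proof.
apply/eqP/andP => [xyw|[/eqP xw /eqP yw]]; last by rewrite -jA yw xw.
by split; rewrite /le -xyw; last rewrite (jC x); rewrite !jA jxx.
Qed.

Fact semilattice_sup_lub (A : {pred T}) w :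
  le (sup A) w = [forall x in A, le x w].
Proof.
(* The claim is generalized to an arbitrary list, filtered by membership in [A], so that induction
   applies. *)
have supP s : le (\big[j/b]_(x <- s | x \in A) x) w = all (fun x => (x \in A) ==> le x w) s.
  elim: s => [|x s IH]; first by rewrite big_nil /le j0x eqxx.
  by rewrite big_cons /=; case: ifP => // xA; rewrite semilattice_join_lub IH.
rewrite /sup supP; apply/allP/forall_inP => [H x xA|H x _].
  by have := H x (mem_index_enum x); rewrite xA.
by apply/implyP; apply: H.
Qed.

(** In a finite join-semilattice with a least element, the join of all common lower bounds is a
    meet. *)
Let meet x y := sup [pred w | le w x && le w y].

Fact semilattice_meet_glb x y w : le x (meet y w) = le x y && le x w.
Proof.
have glb v : le (meet y w) v = [forall x in [pred u | le u y && le u w], le x v].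
  exact: semilattice_sup_lub.
have my : le (meet y w) y by rewrite glb; apply/forall_inP => u /andP[].
have mw : le (meet y w) w by rewrite glb; apply/forall_inP => u /andP[].
apply/idP/idP => [xm|xyw].
  by rewrite (semilattice_le_trans xm my) (semilattice_le_trans xm mw).
have := glb (meet y w); rewrite semilattice_le_refl => /esym/forall_inP; exact.
Qed.

Fact semilattice_le_bottom x : le b x.
Proof. by rewrite /le j0x. Qed.

Fact semilattice_le_top x : le x (sup predT).
Proof.
have := semilattice_sup_lub predT (sup predT); rewrite semilattice_le_refl.
by move/esym/forall_inP; apply.
Qed.

Definition semilattice_lattice : finTBLatticeType (Order.Disp tt tt) :=
  let m1 := Order.Le_isPOrder.Build (Order.Disp tt tt) T
              semilattice_le_refl semilattice_le_anti semilattice_le_trans in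
  let T1 := HB.pack_for (porderType (Order.Disp tt tt)) T m1 in
  let m2 := Order.POrder_MeetJoin_isLattice.Build (Order.Disp tt tt) T1
              semilattice_meet_glb semilattice_join_lub in
  let m3 := Order.hasBottom.Build (Order.Disp tt tt) T1 semilattice_le_bottom in
  let m4 := Order.hasTop.Build (Order.Disp tt tt) T1 semilattice_le_top in
  HB.pack T m1 m2 m3 m4.

End SemilatticeToLattice.

(** * Simplicity of the semirings of maps *)

Section MapSemirings.
Context {disp : Order.disp_t} {L : finTBLatticeType disp}.
Implicit Types (S : {set {ffun L -> L}}) (f g h : {ffun L -> L}).

Lemma JM_le f : is_JM f -> {homo f : x y / x <= y}.
Proof. by move=> fU x y; rewrite !leEjoin eq_sym => /eqP xy; rewrite -fU joinC {2}xy joinC. Qed.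

Lemma le_bigjoin (P : pred L) a : P a -> a <= \join_(b | P b) b.
Proof. by move=> Pa; apply: (@joins_sup _ L L a P id). Qed.

(** The image on maps of a congruence of the abstract semiring, confined to [S]. In place of a
    symmetry clause, the lemmas below carry both [q f g] and [q g f]. *)
Definition congruence_on S (q : {ffun L -> L} -> {ffun L -> L} -> Prop) : Prop :=
  [/\ forall f g, q f g -> (f \in S) && (g \in S),
      forall f, f \in S -> q f f,
      forall f g h, q f g -> q g h -> q f h,
      forall f g h, h \in S -> q f g -> q (fjoin f h) (fjoin g h) &
      forall f g h, h \in S -> q f g ->
        q (fcomp h f) (fcomp h g) /\ q (fcomp f h) (fcomp g h)].

(** A congruence is transported along the isomorphism. Two distinct congruent maps differ at some
    point [x], and by antisymmetry of the order they can be named so that [f x] is not below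
    [g x]. *)
Lemma simple_of_maps (R : finType) (add mul : R -> R -> R) S :
  iso_to_maps add mul S ->
  (forall q, congruence_on S q -> forall f g x, q f g -> q g f -> ~~ (f x <= g x) ->
     {in S &, forall f' g', q f' g'}) ->
  simple_semiring add mul.
Proof.
move=> [phi [phiI phiS phi_onto phiM]] HS.
apply: simple_by_contra => r [rxx rC rT rD rM] x0 y0 rxy /eqP x0y0 x1 y1.
pose q f g := exists x y, [/\ phi x = f, phi y = g & r x y].
have cq : congruence_on S q.
  split=> [f g [x [y [<- <- _]]]|f fS|f g h [x [y [<- <- xy]]] [y' [w [yy' <- yw]]]|
           f g h hS [x [y [<- <- xy]]]|f g h hS [x [y [<- <- xy]]]].
  - by rewrite !phiS.
  - by have [x <-] := phi_onto f fS; exists x, x.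
  - by exists x, w; split=> //; apply: rT xy _; rewrite -(phiI _ _ yy').
  - have [w <-] := phi_onto h hS; exists (add x w), (add y w).
    by rewrite !(proj1 (phiM _ _)); split=> //; apply: rD.
  - have [w <-] := phi_onto h hS; have [wxy xyw] := rM _ _ w xy; split.
      by exists (mul w x), (mul w y); rewrite !(proj2 (phiM _ _)).
    by exists (mul x w), (mul y w); rewrite !(proj2 (phiM _ _)).
suff: q (phi x1) (phi y1) by move=> [x2 [y2 [/phiI -> /phiI ->]]].
have qxy : q (phi x0) (phi y0) by exists x0, y0.
have qyx : q (phi y0) (phi x0) by exists y0, x0; split=> //; apply: rC.
have [w xyw] : exists w, phi x0 w != phi y0 w.
  apply/existsP; apply: contra_neqT x0y0 => /existsPn pxy; apply: phiI.
  by apply/ffunP => w; apply/eqP; have := pxy w; rewrite negbK.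
move: xyw; rewrite eq_le negb_and => /orP[] xyw.
  exact: HS xyw _ _ (phiS _) (phiS _).
exact: HS qyx qxy xyw _ _ (phiS _) (phiS _).
Qed.

Variable S : {set {ffun L -> L}}.

(** Here [b] is least and [t] greatest among the maps of [S]; joining both with [f] relates [f] to
    [t]. *)
Lemma congruence_on_full q b t : congruence_on S q -> q b t -> q t b ->
  {in S, forall f, fjoin b f = f} -> {in S, forall f, fjoin t f = t} ->
  {in S &, forall f g, q f g}.
Proof.
move=> [qS qxx qT qD qM] qbt qtb bf tf f g fS gS.
apply: (qT _ t); first by rewrite -(bf f fS) -(tf f fS); apply: qD.
by rewrite -(bf g gS) -(tf g gS); apply: qD.
Qed.

Lemma fjoin_idl f g : fle f g -> fjoin f g = g.
Proof. by move=> fg; apply/ffunP => x; rewrite ffunE; apply/join_r/fg. Qed.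

Lemma fjoin_idr f g : fle g f -> fjoin f g = f.
Proof. by move=> fg; apply/ffunP => x; rewrite ffunE; apply/join_l/fg. Qed.

(** The sandwich of [h] between [e_{g x,1}] and [e_{0,x}] only records whether [h x <= g x]. It
    gives the zero map for [h = g] and the greatest map [e_{0,1}] for [h = f]. *)
Lemma simple_Res (R : finType) (add mul : R -> R -> R) :
  subsemiring is_Res S -> iso_to_maps add mul S ->
  (forall a b : L, e_map a b \in S) -> simple_semiring add mul.
Proof.
move=> [_ SRes _ _] iso eS; apply: (simple_of_maps iso) => q cq f g x qfg qgf fgx.
have [qS qxx qT qD qM] := cq.
have [/andP[fS gS] eab] := (qS _ _ qfg, fun h hS => proj2 (SRes h hS)).
have compE h (hS : h \in S) :
    fcomp (e_map (g x) \top) (fcomp h (e_map \bot x)) =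
    e_map \bot (if h x <= g x then \bot else \top).
  by apply/ffunP => y; rewrite !ffunE; case: (y <= \bot) => //; rewrite eab // le0x.
apply: (congruence_on_full (b := e_map \bot \bot) (t := e_map \bot \top)) => //.
- have := proj1 (qM _ _ _ (eS (g x) \top) (proj2 (qM _ _ _ (eS \bot x) qgf))).
  by rewrite !compE // lexx (negPf fgx).
- have := proj1 (qM _ _ _ (eS (g x) \top) (proj2 (qM _ _ _ (eS \bot x) qfg))).
  by rewrite !compE // lexx (negPf fgx).
- by move=> h hS; apply: fjoin_idl => y; rewrite ffunE if_same le0x.
move=> h hS; apply: fjoin_idr => y; rewrite ffunE; case: ifP => [|_]; last exact: lex1.
by rewrite lex0 => /eqP ->; rewrite eab.
Qed.

Lemma simple_Res1 (R : finType) (add mul : R -> R -> R) :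
  (2 < #|L|)%N -> top_join_irreducible (L := L) ->
  subsemiring is_Res1 S -> iso_to_maps add mul S ->
  (forall a : L, a != \top -> f_map a \bot \in S) ->
  (forall a b : L, a != \bot -> a != \top -> exists2 f, f \in S & f a = b) ->
  simple_semiring add mul.
Proof.
move=> L2 irr [_ SRes _ Sc] iso fS Strans.
apply: (simple_of_maps iso) => q cq f g x qfg qgf fgx.
have [qS qxx qT qD qM] := cq; have /andP[fIS gIS] := qS _ _ qfg.
have S0 h (hS : h \in S) : h \bot = \bot by have [[]] := SRes h hS.
have S1 h (hS : h \in S) : h \top = \top by have [] := SRes h hS.
have Sle h (hS : h \in S) : {homo h : u v / u <= v} by apply: JM_le; have [[]] := SRes h hS.
have neq01 : \bot != \top :> L.
  apply: contraTneq L2 => L01; rewrite -leqNgt; apply: (@leq_trans 1) => //.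
  apply/card_le1_eqP => u v _ _; apply/le_anti.
  by rewrite (le_trans (lex1 u)) -?L01 ?le0x // (le_trans (lex1 v)) -?L01 ?le0x.
(* [c] is the greatest element below the top: join-irreducibility keeps this join away from the top.
   Were it the bottom, [L] would have at most two elements. *)
pose c : L := \join_(a | a != \top) a.
have cP a : a != \top -> a <= c by move=> aP; apply: le_bigjoin.
have c1 : c != \top by apply: (big_ind (fun a : L => a != \top)).
have c0 : c != \bot.
  apply: contraTneq L2 => c0; rewrite -leqNgt -(cardsT L).
  apply: leq_trans (_ : #|[set \bot; \top : L]| <= 2)%N; last by rewrite cards2; case: eqP.
  apply/subset_leq_card/subsetP => u _; rewrite !inE -lex0 -c0.
  by case: eqVneq => [_|/cP ->] //; rewrite orbT.
(* Composing [f_{w,0}] after [h] gives [f_{u,0}], where [u] is the greatest element that [h] sends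
   below [w], that is, the residual of [h] at [w]. *)
have FcompE h w : h \in S -> w != \top -> exists2 u, u != \top &
    fcomp (f_map w \bot) h = f_map u \bot /\ forall y, (y <= u) = (h y <= w).
  move=> hS w1; pose u : L := \join_(y | h y <= w) y.
  have hu : h u <= w.
    apply: (big_ind (fun y => h y <= w)) => [|y1 y2 h1 h2|//]; first by rewrite S0 ?le0x.
    by have [[hJ _] _] := SRes h hS; rewrite hJ leUx h1.
  have uE y : (y <= u) = (h y <= w).
    by apply/idP/idP => [yu|hy]; [apply: le_trans hu; apply: Sle|apply: le_bigjoin].
  exists u; first by apply: contraNneq w1 => u1; rewrite -le1x -(S1 h hS) -u1.
  by split=> //; apply/ffunP => y; rewrite !ffunE uE.
have FI u v : fjoin (f_map u \bot) (f_map v \bot) = f_map (u `&` v) \bot.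
  apply/ffunP => y; rewrite !ffunE lexI.
  by case: (y <= u); case: (y <= v); rewrite ?join0x ?joinx0 ?joinxx.
have Fbot : {in S, forall h, fjoin (f_map c \bot) h = h}.
  move=> h hS; apply: fjoin_idl => y; rewrite ffunE; case: ifPn => [_|yc]; first exact: le0x.
  suff -> : y = \top by rewrite S1.
  by apply: contraNeq yc => /cP.
have Ftop : {in S, forall h, fjoin (f_map \bot \bot) h = f_map \bot \bot}.
  move=> h hS; apply: fjoin_idr => y; rewrite ffunE; case: ifPn => [|_]; last exact: lex1.
  by rewrite lex0 => /eqP ->; rewrite S0.
suff [q1 q2] : q (f_map c \bot) (f_map \bot \bot) /\ q (f_map \bot \bot) (f_map c \bot).
  exact: (congruence_on_full cq q1 q2).
have gx1 : g x != \top by apply: contraNneq fgx => ->; apply: lex1.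
(* Descent on [w]: if [h w = c], composition with [h] turns [f_{c,0}] and [f_{w,0}] into [f_{v,0}]
   and [f_{u,0}], where [w] is below [v] but not below [u]. Joining with [f_{w,0}] then replaces [w]
   by the strictly smaller meet of [u] and [w], until the bottom is reached. *)
suff [w [cw q1 q2]] : exists w, [/\ ~~ (c <= w), q (f_map c \bot) (f_map w \bot) &
                                q (f_map w \bot) (f_map c \bot)].
  have [n] := ubnP #|[pred y : L | y <= w]|; elim: n w cw q1 q2 => // n IH w cw q1 q2.
  rewrite ltnS => wn; have [w0|w0] := eqVneq w \bot; first by move: q1 q2; rewrite w0.
  have w1 : w != \top by apply: contraNneq cw => ->; apply: lex1.
  have [h hS hw] := Strans w c w0 w1.
  have [u u1 [uE uP]] := FcompE h w hS w1.
  have [v v1 [vE vP]] := FcompE h c hS c1.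
  have wv : w <= v by rewrite vP hw.
  have wu : ~~ (w <= u) by rewrite uP hw.
  have := proj2 (qM _ _ _ hS q1); rewrite uE vE => /(qD _ _ _ (fS w w1)).
  have := proj2 (qM _ _ _ hS q2); rewrite uE vE => /(qD _ _ _ (fS w w1)).
  rewrite !FI (meet_r wv) => q3 q4.
  apply: (IH (u `&` w)); first by rewrite lexI negb_and cw orbT.
  - exact: qT q1 q4.
  - exact: qT q3 q2.
  apply: leq_trans wn; apply: proper_card; apply/properP; split.
    by apply/subsetP => y; rewrite !inE lexI => /andP[].
  by exists w; rewrite !inE ?lexx // lexI negb_and wu.
(* Start of the descent: since [h c = x], the map [g] yields [f_{c,0}] and the map [f] yields
   [f_{u,0}] with [c] not below [u]. *)
have [h hS hc] := Strans c x c0 c1.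
have [u u1 [uE uP]] := FcompE _ _ (Sc _ _ fIS hS) gx1.
have [v v1 [vE vP]] := FcompE _ _ (Sc _ _ gIS hS) gx1.
have vc : v = c by apply: le_anti; rewrite cP //= vP ffunE hc.
exists u; rewrite uP ffunE hc fgx -vc -uE -vE; split=> //.
  by have [q1 _] := qM _ _ _ (fS (g x) gx1) (proj2 (qM _ _ _ hS qgf)).
by have [q1 _] := qM _ _ _ (fS (g x) gx1) (proj2 (qM _ _ _ hS qfg)).
Qed.

(** Composing with constants gives congruent [k_u] and [k_v] with [u] not below [v]. A map equal to
    [b] exactly on the elements below [v] sends them to [k_b] and to a constant strictly above it,
    so every constant climbs to [k_1] inside its class. *)
Lemma simple_JM (R : finType) (add mul : R -> R -> R) :
  subsemiring is_JM S -> iso_to_maps add mul S ->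
  (forall a : L, k_map a \in S) ->
  (forall a b : L, b != \top -> exists2 f, f \in S &
     forall x, (x <= a -> f x = b)%O /\ (~~ (x <= a) -> b < f x)%O) ->
  simple_semiring add mul.
Proof.
move=> [_ SJM _ _] iso kS Sf; apply: (simple_of_maps iso) => q cq f g x qfg qgf fgx.
have [qS qxx qT qD qM] := cq; have /andP[fS gS] := qS _ _ qfg.
have kl a h : fcomp h (k_map a) = k_map (h a) by apply/ffunP => y; rewrite !ffunE.
have kj a b : fjoin (k_map a) (k_map b) = k_map (a `|` b) by apply/ffunP => y; rewrite !ffunE.
pose u := f x; pose v := g x.
have quv : q (k_map u) (k_map v) by rewrite /u /v -!kl; have [] := qM _ _ _ (kS x) qfg.
have qvu : q (k_map v) (k_map u) by rewrite /u /v -!kl; have [] := qM _ _ _ (kS x) qgf.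
have up b : b != \top -> exists2 b', b < b' & q (k_map b) (k_map b') /\ q (k_map b') (k_map b).
  move=> b1; have [h hS hP] := Sf v b b1; exists (h u); first by apply: (proj2 (hP u)).
  have hv : h v = b by apply: (proj1 (hP v)).
  by rewrite -hv -!(kl _ h); split; [have [] := qM _ _ h hS qvu|have [] := qM _ _ h hS quv].
have top b : q (k_map b) (k_map \top) /\ q (k_map \top) (k_map b).
  have [n] := ubnP #|[pred w : L | b < w]|; elim: n b => // n IH b; rewrite ltnS => bn.
  have [->|/up[b' bb' [q1 q2]]] := eqVneq b \top; first by split; apply: qxx.
  have [] := IH b' _; last by move=> q3 q4; split; [apply: qT q1 q3|apply: qT q4 q2].
  apply: leq_trans bn; apply: proper_card; apply/properP; split.
    by apply/subsetP => w; rewrite !inE; apply: lt_trans.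
  by exists b'; rewrite !inE ?ltxx.
have [q1 q2] := top \bot.
apply: (congruence_on_full cq q1 q2) => h hS.
  by apply: fjoin_idl => y; rewrite ffunE le0x.
by apply: fjoin_idr => y; rewrite ffunE lex1.
Qed.

(** Sandwiching between [f_{g x,b}] and [f_{a,x}] sends [g] to [f_{a,b}] and [f] to [k_1]. Hence
    each [f_{a,b}] is congruent to [k_1], and so is every map above one of them. *)
Lemma simple_JM1 (R : finType) (add mul : R -> R -> R) :
  subsemiring is_JM1 S -> iso_to_maps add mul S ->
  (forall a b : L, a != \top -> f_map a b \in S) ->
  (forall f, f \in S -> exists a b : L, a != \top /\ fle (f_map a b) f) ->
  simple_semiring add mul.
Proof.
move=> [_ SJM _ _] iso fS Sf; apply: (simple_of_maps iso) => q cq f g x qfg qgf fgx.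
have [qS qxx qT qD qM] := cq; have /andP[fIS gIS] := qS _ _ qfg.
have S1 h (hS : h \in S) : h \top = \top by have [] := SJM h hS.
have gx1 : g x != \top by apply: contraNneq fgx => ->; apply: lex1.
have x1 : x != \top by apply: contraNneq gx1 => ->; apply/eqP/S1.
have compE h (hS : h \in S) a b :
    fcomp (f_map (g x) b) (fcomp h (f_map a x)) = f_map a (if h x <= g x then b else \top).
  apply/ffunP => y; rewrite !ffunE; case: (y <= a) => //.
  by rewrite S1 // le1x (negPf gx1).
have ke a : f_map a \top = k_map (\top : L) by apply/ffunP => y; rewrite !ffunE if_same.
have qf a b : a != \top -> q (f_map a b) (k_map \top) /\ q (k_map \top) (f_map a b).
  move=> a1; split.
    have := proj1 (qM _ _ _ (fS (g x) b gx1) (proj2 (qM _ _ _ (fS a x a1) qgf))).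
    by rewrite !compE // lexx (negPf fgx) ke.
  have := proj1 (qM _ _ _ (fS (g x) b gx1) (proj2 (qM _ _ _ (fS a x a1) qfg))).
  by rewrite !compE // lexx (negPf fgx) ke.
have qtop h : h \in S -> q h (k_map \top) /\ q (k_map \top) h.
  move=> hS; have [a [b [a1 hab]]] := Sf h hS; have [q1 q2] := qf a b a1.
  have tE : k_map (\top : L) = fjoin (k_map \top) h.
    by apply/esym/fjoin_idr => y; rewrite ffunE lex1.
  by rewrite -(fjoin_idl hab) tE; split; apply: qD.
by move=> h h' /qtop[q1 _] /qtop[_ q2]; apply: qT q1 q2.
Qed.

End MapSemirings.

(** * Semimodules *)

Section SemimoduleRepresentation.
Variables (R U : finType) (add mul : R -> R -> R).
Variables (P : pred U) (j : U -> U -> U) (b : U) (act : R -> U -> U).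
Hypotheses (jA : associative j) (jC : commutative j) (jxx : idempotent_op j).
Hypotheses (Pb : P b) (Pj : forall x y, P x -> P y -> P (j x y)).
Hypothesis jb : forall x, P x -> j b x = x.
Hypothesis Pact : forall r x, P x -> P (act r x).
Hypothesis actD : forall r s x, P x -> act (add r s) x = j (act r x) (act s x).
Hypothesis actM : forall r s x, P x -> act (mul r s) x = act r (act s x).
Hypothesis actJ : forall r x y, P x -> P y -> act r (j x y) = j (act r x) (act r y).
Hypothesis act_faithful : forall r s, (forall x, P x -> act r x = act s x) -> r = s.

Let T : finType := {x : U | P x}.
Let jT (x y : T) : T := exist _ (j (sval x) (sval y)) (Pj (svalP x) (svalP y)).
Let bT : T := exist _ b Pb.

Fact semimodule_joinA : associative jT. Proof. by move=> x y w; apply/val_inj/jA. Qed.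
Fact semimodule_joinC : commutative jT. Proof. by move=> x y; apply/val_inj/jC. Qed.
Fact semimodule_joinxx : idempotent_op jT. Proof. by move=> x; apply/val_inj/jxx. Qed.
Fact semimodule_join0x : left_id bT jT.
Proof. by move=> x; apply/val_inj/jb/(svalP x). Qed.

(** The semimodule is a subset [P] of an ambient type [U], so that it can be a left ideal of the
    semiring as well as a family of sets with intersection as join. *)
Definition semimodule_lattice :=
  semilattice_lattice semimodule_joinA semimodule_joinC semimodule_joinxx semimodule_join0x.
Local Notation L := semimodule_lattice.
Definition lat_val (x : L) : U := sval (x : T).
Definition lat_elt x (Px : P x) : L := exist (fun x => P x) x Px.

Lemma lat_valP (x : L) : P (lat_val x). Proof. exact: (svalP (x : T)). Qed.
Lemma lat_val_inj : injective lat_val.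
Proof. by move=> x y xy; apply: (val_inj (xy : sval (x : T) = sval (y : T))). Qed.
Lemma lat_eltK x (Px : P x) : lat_val (lat_elt Px) = x. Proof. by []. Qed.
Lemma lat_valU x y : lat_val (x `|` y) = j (lat_val x) (lat_val y). Proof. by []. Qed.
Lemma lat_val0 : lat_val \bot = b. Proof. by []. Qed.
Lemma lat_le x y : (x <= y) = (j (lat_val x) (lat_val y) == lat_val y).
Proof. by rewrite -lat_valU (inj_eq lat_val_inj) eq_joinr. Qed.

Definition lat_act r (x : L) : L := lat_elt (Pact r (lat_valP x)).
Definition lat_map r : {ffun L -> L} := [ffun x => lat_act r x].
Definition lat_maps : {set {ffun L -> L}} := [set lat_map r | r in R].

Lemma lat_mapE r x : lat_val (lat_map r x) = act r (lat_val x).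
Proof. by rewrite ffunE. Qed.

Lemma mem_lat_maps r (f : {ffun L -> L}) :
  (forall x, lat_val (f x) = act r (lat_val x)) -> f \in lat_maps.
Proof.
move=> fr; apply/imsetP; exists r => //; apply/ffunP => x; apply: lat_val_inj.
by rewrite lat_mapE fr.
Qed.

Lemma lat_map_JM r : is_JM (lat_map r).
Proof.
by move=> x y; apply: lat_val_inj; rewrite lat_valU !lat_mapE lat_valU actJ //; apply: lat_valP.
Qed.

Lemma lat_mapD r s : lat_map (add r s) = fjoin (lat_map r) (lat_map s).
Proof.
apply/ffunP => x; apply: lat_val_inj; rewrite lat_mapE [in RHS]ffunE lat_valU !lat_mapE actD //.
exact: lat_valP.
Qed.

Lemma lat_mapM r s : lat_map (mul r s) = fcomp (lat_map r) (lat_map s).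
Proof.
apply/ffunP => x; apply: lat_val_inj; rewrite lat_mapE [in RHS]ffunE !lat_mapE actM //.
exact: lat_valP.
Qed.

Lemma lat_maps_iso : iso_to_maps add mul lat_maps.
Proof.
exists lat_map; split=> [r s rs|r|f /imsetP[r _ ->]|r s]; last 1 first.
- by rewrite lat_mapD lat_mapM.
- by apply: act_faithful => x Px; rewrite -(lat_eltK Px) -!lat_mapE rs.
- exact: imset_f.
by exists r.
Qed.

Lemma lat_maps_subsemiring (Q : {ffun L -> L} -> Prop) : R ->
  (forall r, Q (lat_map r)) -> subsemiring Q lat_maps.
Proof.
move=> r0 QR; split=> [|f /imsetP[r _ ->] //|f g /imsetP[r _ ->] /imsetP[s _ ->]|
                       f g /imsetP[r _ ->] /imsetP[s _ ->]].
- by apply/set0Pn; exists (lat_map r0); apply: imset_f.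
- by rewrite -lat_mapD imset_f.
by rewrite -lat_mapM imset_f.
Qed.

End SemimoduleRepresentation.

(** * Finite simple additively idempotent semirings *)

Section SimpleIdempotent.
Context {disp : Order.disp_t} {R : finTBLatticeType disp}.
Implicit Types (mul : R -> R -> R) (x y r s : R).

Definition simple_idempotent mul : Prop :=
  [/\ associative mul,
      (forall x y w, mul x (y `|` w) = mul x y `|` mul x w),
      (forall x y w, mul (x `|` y) w = mul x w `|` mul y w),
      simple_semiring Order.join mul & (2 < #|R|)%N].

(** Passing to the opposite multiplication turns results about left ideals into results about right
    ideals. *)
Lemma simple_idempotent_op mul :
  simple_idempotent mul -> simple_idempotent (fun x y => mul y x).
Proof.
move=> [mA mUr mUl simp R3]; split=> // r [rxx rC rT rD rM].
by apply: simp; split=> // x y w /(rM _ _ w)[].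
Qed.

Variable mul : R -> R -> R.
Hypothesis Hmul : simple_idempotent mul.
Local Notation "x * y" := (mul x y).

Let mA : associative mul. Proof. by case: Hmul. Qed.
Let mUr x y w : x * (y `|` w) = x * y `|` x * w. Proof. by case: Hmul. Qed.
Let mUl x y w : (x `|` y) * w = x * w `|` y * w. Proof. by case: Hmul. Qed.
Let R3 : (2 < #|R|)%N. Proof. by case: Hmul. Qed.

Lemma simple_cases (q : R -> R -> Prop) : congruence Order.join mul q ->
  (forall x y, q x y -> x = y) \/ (forall x y, q x y).
Proof.
by case: Hmul => _ _ _ simp _ /simp[qE|]; [left=> x y /qE|right].
Qed.

Lemma le_mul x y u v : x <= y -> u <= v -> x * u <= y * v.
Proof.
move=> /join_r <- /join_r <-; rewrite mUr mUl; exact: le_trans (leUl _ _) (leUl _ _).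
Qed.

Lemma le_mull w x y : x <= y -> w * x <= w * y. Proof. exact: le_mul. Qed.
Lemma le_mulr w x y : x <= y -> x * w <= y * w. Proof. by move=> xy; apply: le_mul. Qed.

(** Excludes the trivial alternative for a congruence whose classes are told apart by one Boolean
    test. *)
Lemma card_gt2_inj (f : R -> bool) : ~ injective f.
Proof. by move=> /leq_card; rewrite card_bool leqNgt R3. Qed.

Lemma card_gt2_all_eq : ~ (forall x y : R, x = y).
Proof. by move=> H; apply: (@card_gt2_inj xpredT) => x y _; apply: H. Qed.

Lemma neq_bot_top : \bot != \top :> R.
Proof.
apply/eqP => L01; apply: card_gt2_all_eq => x y; apply: le_anti.
by rewrite (le_trans (lex1 x)) -?L01 ?le0x // (le_trans (lex1 y)) -?L01 ?le0x.
Qed.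

(** If the congruence were full, [r * u] would depend on [r] alone, as an idempotent map [phi] whose
    kernel is a congruence; so [phi] is the identity or constant. In both cases the partition into
    [0] and the rest is a congruence, which is neither trivial nor full. *)
Lemma mulr_faithful x y : (forall r, r * x = r * y) -> x = y.
Proof.
pose q x y := forall r, r * x = r * y.
have [qE|qF] : (forall x y, q x y -> x = y) \/ (forall x y, q x y).
  apply: simple_cases; split=> // [u v uv r|u v w uv vw r|u v w uv r|u v w uv]; 
    rewrite /q ?mUr ?uv ?vw //.
  by split=> r; rewrite !mA ?uv // -!mA uv.
  by move=> xy; apply: qE.
move=> _; exfalso; have {}qF r u v : r * u = r * v by apply: qF.
pose phi x := x * \bot.
have phiE : (forall x, phi x = x) \/ (forall x y, phi x = phi y).
  have [pE|] : (forall x y, phi x = phi y -> x = y) \/ (forall x y, phi x = phi y).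
  - apply: simple_cases; split=> // [u' v' w -> //|u' v' w'|u' v' w']; rewrite /phi.
      by rewrite !mUl => ->.
    by rewrite -!mA (qF w' _ (v' * \bot)) (qF u' _ \bot) (qF v' _ \bot) => ->.
  - by left=> u; apply: pE; rewrite /phi -mA; apply: qF.
  by right.
pose p (u v : R) := (u == \bot) = (v == \bot).
have [pE|pF] : (forall x y, p x y -> x = y) \/ (forall x y, p x y).
- apply: simple_cases; split=> // [u v w uv vw|u v w uv|u v w uv]; rewrite /p ?join_eq0 ?uv //.
  rewrite (qF w u v) (qF u w \bot) (qF v w \bot) -/(phi u) -/(phi v); split=> //.
  by case: phiE => phiE; [rewrite !phiE|rewrite (phiE u v)].
- exact: card_gt2_inj pE.
by have := pF \bot \top; rewrite /p eqxx eq_sym (negPf neq_bot_top).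
Qed.


(* The Rees congruence of an ideal that is an up-set. *)
Lemma ideal_cases (I : R -> Prop) :
  (forall x y, x <= y -> I x -> I y) -> (forall w x, I x -> I (w * x) /\ I (x * w)) ->
  (forall x y, I x -> I y -> x = y) \/ (forall x, I x).
Proof.
move=> Iup Imul; pose q (x y : R) := x = y \/ I x /\ I y.
have [qE|qF] : (forall x y, q x y -> x = y) \/ (forall x y, q x y).
- apply: simple_cases; split=> [x|x y [->|[Ix Iy]]|x y w [-> //|[Ix Iy]] [<-|[_ Iw]]|
                                x y w [->|[Ix Iy]]|x y w [->|[Ix Iy]]].
  + by left.
  + by left.
  + by right.
  + by right.
  + by right.
  + by left.
  + by right; split; [apply: Iup Ix|apply: Iup Iy]; apply: leUl.
  + by split; left.
  have [[wx xw] [wy yw]] := (Imul w x Ix, Imul w y Iy).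
  by split; right.
- by left=> x y Ix Iy; apply: qE; right.
right=> x; case: (qF \bot \top) => [/eqP|[Ibot _]]; first by rewrite (negPf neq_bot_top).
exact: Iup (le0x x) Ibot.
Qed.

(** The elements above [0 * 0] form an ideal containing all products. If it had only one element,
    all products would equal the top, against faithfulness; so it contains [0]. *)
Lemma mul_bot_bot : \bot * \bot = \bot :> R.
Proof.
have prod_ge x y : \bot * \bot <= x * y by apply: le_mul; apply: le0x.
have [|w x _|E|F] := @ideal_cases (fun x => \bot * \bot <= x).
- by move=> x y xy x0; apply: le_trans xy.
- by split; apply: prod_ge.
- have top x y : x * y = \top by apply: E; rewrite ?prod_ge ?lex1.
  by case: card_gt2_all_eq => x y; apply: mulr_faithful => r; rewrite !top.
by apply/eqP; rewrite -lex0.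
Qed.

(** Were all elements to act alike on [R * 0], then [r * (r0 * 0) = r * 0] for every [r], and
    [mulr_faithful] would give [r0 * 0 = 0]. *)
Lemma left_ideal_faithful x y : (exists r, r * \bot <> \bot) ->
  (forall t, x * (t * \bot) = y * (t * \bot)) -> x = y.
Proof.
move=> [r0 r0P].
have [qE|qF] : (forall x y, (forall t, x * (t * \bot) = y * (t * \bot)) -> x = y)
            \/ (forall x y t, x * (t * \bot) = y * (t * \bot)).
- apply: simple_cases; split=> // [u v w uv vw t|u v w uv t|u v w uv].
  + by rewrite uv vw.
  + by rewrite !mUl uv.
  by split=> t; rewrite -!mA ?uv // (mA w) uv.
- exact: qE.
case: r0P; rewrite -{1}mul_bot_bot -[RHS]mul_bot_bot; apply: mulr_faithful => r.
by rewrite mA; apply: qF.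
Qed.

(** Elements of [R * 0] are left zeros, so [a] and [a \/ x] pass the same tests
    [s * u * (t * 0) \in A]. If these tests define the trivial congruence, then [a = a \/ x]. If
    they define the full one, the weaker tests [u * (t * 0) \in A] also define a congruence: it
    separates [m0] from [m1], yet has at most two classes. *)
Lemma left_zero_separation (A : {pred R}) (a x m0 m1 : R) :
  (forall r, \bot * r = \bot) ->
  a * \bot = a -> x * \bot = x -> m0 * \bot = m0 -> m1 * \bot = m1 ->
  {in [pred x | x * \bot == x] &, forall x y, (x `|` y \in A) = (x \in A) && (y \in A)} ->
  m0 \in A -> m1 \notin A ->
  (forall r, r * a \in A -> r * x \in A) -> x <= a.
Proof.
move=> bl aM xM m0M m1M AU m0A m1A ax.
have Ml u v : u * \bot = u -> u * v = u by move=> uM; rewrite -uM -mA bl.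
have MA u v w : ((u `|` v) * (w * \bot) \in A) = (u * (w * \bot) \in A) && (v * (w * \bot) \in A).
  by rewrite mUl AU // inE -!mA mul_bot_bot.
pose q u v := forall s t, (s * u * (t * \bot) \in A) = (s * v * (t * \bot) \in A).
have [qE|qF] : (forall x y, q x y -> x = y) \/ (forall x y, q x y).
- apply: simple_cases; split=> // [u v uv s t|u v w uv vw s t|u v w uv s t|u v w uv].
  + by rewrite uv.
  + by rewrite uv.
  + by rewrite !mUr !MA uv.
  split=> s t; first by rewrite !(mA s) uv.
  have e z : s * (z * w) * (t * \bot) = s * z * (w * t * \bot) by rewrite !mA.
  by rewrite !e uv.
- suff -> : a = a `|` x by apply: leUr.
  apply: qE => s t; rewrite mUr MA -!(mA s) (Ml a) // (Ml x) //.
  by case: (boolP (s * a \in A)) => // /ax ->.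
have [pE|pF] : (forall u v, (forall t, (u * (t * \bot) \in A) = (v * (t * \bot) \in A)) -> u = v)
  \/ (forall u v t, (u * (t * \bot) \in A) = (v * (t * \bot) \in A)).
- apply: simple_cases; split=> // [u v w uv vw t|u v w uv t|u v w uv].
  + by rewrite uv.
  + by rewrite !MA uv.
  by split=> t; [apply: qF|rewrite -!mA (mA w) uv].
- case: (@card_gt2_inj (fun u => u * \bot \in A)) => u v uv; apply: pE => t.
  have e w : (w * (t * \bot) \in A) = (w * \bot \in A).
    by have := qF (t * \bot) \bot w \bot; rewrite mul_bot_bot -!mA !mul_bot_bot.
  by rewrite !e.
by have := pF m0 m1 \bot; rewrite (Ml m0) // (Ml m1) // m0A (negPf m1A).
Qed.

End SimpleIdempotent.

(** * Representation on the left ideal generated by the least element *)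

Section SimpleIdempotentCases.
Context {disp : Order.disp_t} {R : finTBLatticeType disp}.
Variable mul : R -> R -> R.
Hypothesis Hmul : simple_idempotent mul.
Local Notation "x * y" := (mul x y).

Let mA : associative mul. Proof. by case: Hmul. Qed.
Let mUr x y w : x * (y `|` w) = x * y `|` x * w. Proof. by case: Hmul. Qed.
Let mUl x y w : (x `|` y) * w = x * w `|` y * w. Proof. by case: Hmul. Qed.
Let bb : \bot * \bot = \bot. Proof. exact: mul_bot_bot Hmul. Qed.
Let lel w x y : x <= y -> w * x <= w * y. Proof. exact: (le_mull Hmul). Qed.
Let ler w x y : x <= y -> x * w <= y * w. Proof. exact: (le_mulr Hmul). Qed.
Let neq01 : \bot != \top :> R. Proof. exact: neq_bot_top Hmul. Qed.

Section LeftIdealOfBottom.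
Hypothesis bot_not_right_absorbing : exists r, r * \bot <> \bot.

Let P : pred R := fun x => x * \bot == x.
Let Pb : P \bot. Proof. exact/eqP. Qed.
Let Pj x y : P x -> P y -> P (x `|` y).
Proof. by move=> /eqP Px /eqP Py; rewrite /P mUl Px Py. Qed.
Let jb x : P x -> \bot `|` x = x. Proof. by rewrite join0x. Qed.
Let Pact r x : P x -> P (r * x). Proof. by move=> /eqP Px; rewrite /P -mA Px. Qed.
Let actD r s x : P x -> (r `|` s) * x = r * x `|` s * x. Proof. by []. Qed.
Let actM r s x : P x -> r * s * x = r * (s * x). Proof. by rewrite mA. Qed.
Let actJ r x y : P x -> P y -> r * (x `|` y) = r * x `|` r * y. Proof. by []. Qed.
Let act_faithful r s : (forall x, P x -> r * x = s * x) -> r = s.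
Proof.
move=> rs; apply: (left_ideal_faithful Hmul) => // t.
by apply: rs; rewrite /P -mA bb.
Qed.

Let L := semimodule_lattice joinA joinC joinxx Pb Pj jb.
Let val (x : L) : R := lat_val x.
Let S := lat_maps joinA joinC joinxx Pb Pj jb Pact.
Let S_iso : iso_to_maps Order.join mul S.
Proof. exact: lat_maps_iso actD actM act_faithful. Qed.
Let val_le (x y : L) : (x <= y) = (val x <= val y).
Proof. by rewrite lat_le eq_joinr. Qed.
Let valP (x : L) : val x * \bot = val x. Proof. exact/eqP/(lat_valP x). Qed.
Let memS r (f : {ffun L -> L}) : (forall x, val (f x) = r * val x) -> f \in S.
Proof. exact: mem_lat_maps. Qed.

Let L_gt1 : (1 < #|L|)%N.
Proof.
rewrite ltnNge; apply/negP => /card_le1_eqP L1; case: (card_gt2_all_eq Hmul) => r s.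
apply: act_faithful => x Px; pose elt r := lat_elt joinA joinC joinxx Pb Pj jb (Pact r Px).
by have /(congr1 val) := L1 (elt r) (elt s) isT isT.
Qed.

Lemma simple_idempotent_JM : (forall r, \bot * r = \bot) ->
  exists (d : Order.disp_t) (L : finTBLatticeType d) (S : {set {ffun L -> L}}),
         [/\ (1 < #|L|)%N, subsemiring is_JM S, iso_to_maps Order.join mul S &
             [/\ (forall a : L, k_map a \in S),
                 (forall f, f \in S -> exists a : L, fle (k_map a) f) &
                 (forall a b : L, b != \top -> exists2 f, f \in S &
                     forall x, (x <= a -> f x = b)%O /\ (~~ (x <= a) -> b < f x)%O)]].
Proof.
move=> bl; exists (Order.Disp tt tt), L, S.
have Ml (x : L) v : val x * v = val x by rewrite -valP -mA bl.
split=> //; first by apply: (lat_maps_subsemiring actD actM \bot) => r; apply: lat_map_JM.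
(* The constant [k_a] is multiplication by [a] itself, a left zero. *)
split=> [a|f _|a b b1].
- by apply: (@memS (val a)) => x; rewrite ffunE Ml.
- by exists \bot => x; rewrite ffunE le0x.
(* [F] is the greatest element with [F * a <= b]. The left zero [b] is among the candidates, so [F]
   maps everything above [b]; and [F * x = b] means that [r * a <= b] always implies [r * x <= b],
   whence [x <= a] by separation. *)
pose F := \join_(r | r * val a <= val b) r.
have FP (x : L) r : r * val a <= val b -> r * val x <= F * val x.
  by move=> ra; apply/ler/(le_bigjoin (P := fun r => r * val a <= val b)).
have Fa : F * val a <= val b.
  apply: (big_ind (fun r => r * val a <= val b)) => //; first by rewrite bl le0x.
  by move=> r s ra sa; rewrite mUl leUx ra.
have Fb x : val b <= F * val x by rewrite -(Ml b (val x)); apply: FP; rewrite Ml.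
exists (lat_map joinA joinC joinxx Pb Pj jb Pact F); first exact: imset_f.
move=> x; split=> [xa|xa].
  apply: lat_val_inj; rewrite lat_mapE; apply: le_anti; rewrite Fb andbT.
  by apply: le_trans Fa; apply: lel; rewrite -val_le.
rewrite lt_neqAle val_le /val lat_mapE Fb andbT.
apply: contraNneq xa => /(congr1 val); rewrite /val lat_mapE => Fx.
rewrite val_le.
apply: (@left_zero_separation _ _ _ Hmul [pred y | y <= val b] _ _ (val b) (val \top)) => //.
- by move=> u v _ _; rewrite !inE leUx.
- by rewrite inE.
- by rewrite inE -val_le le1x.
by move=> r ra; apply: le_trans (FP x r ra) _; rewrite /val -Fx.
Qed.

Section BothSides.
Hypothesis bot_not_left_absorbing : exists r, \bot * r <> \bot.

(** Apply the dichotomy to the up-set generated by [R * 1 * R]. If it is [{1}], faithfulness on both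
    sides gives the claim. If it is everything, some [u * 1 * v] is [0]; then [0 * R * v] and
    [0 * R * 0] vanish, which forces [v = 0] and [R * 0 = 0]. *)
Lemma top_absorbing r : r * \top = \top /\ \top * r = \top.
Proof.
pose I (x : R) := exists u v, u * \top * v <= x.
have [x y xy|w x|IE|IF] := @ideal_cases _ _ _ Hmul I.
- by move=> [u [v uv]]; exists u, v; apply: le_trans xy.
- move=> [u [v uv]]; split; first by exists (w * u), v; rewrite -!mA; apply: lel; rewrite mA.
  by exists u, (v * w); rewrite mA; apply: ler.
- have uTv u v : u * \top * v = \top.
    by apply: IE; [exists u, v|exists u, v; apply: lex1].
  have uT u : u * \top = \top.
    have uT v w : v * \top = w * \top.
      by apply: (mulr_faithful (simple_idempotent_op Hmul)) => t; rewrite !uTv.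
    by rewrite -[RHS](uTv u \top); apply: uT.
  by split=> //; apply: (mulr_faithful Hmul) => t; rewrite mA uTv uT.
have [u [v uv]] := IF \bot.
have btv t : \bot * t * v = \bot.
  apply/eqP; rewrite -lex0; apply: le_trans uv; apply: ler.
  exact: le_trans (ler _ (le0x u)) (lel _ (lex1 t)).
have btb t : \bot * t * \bot = \bot.
  by apply/eqP; rewrite -lex0 -[X in _ <= X](btv t); apply/lel/le0x.
have wv w : w * v = \bot.
  apply: (left_ideal_faithful (simple_idempotent_op Hmul)) => // t.
  by rewrite mA -(mA \bot) btv btb.
case: bot_not_right_absorbing => w []; rewrite -[RHS](wv w); congr (_ * _).
apply: (left_ideal_faithful (simple_idempotent_op Hmul)) => // t.
by rewrite btv btb.
Qed.

Let rT r : r * \top = \top. Proof. by have [] := top_absorbing r. Qed.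
Let Tr r : \top * r = \top. Proof. by have [] := top_absorbing r. Qed.

(** The tests define a congruence that separates [0] from [1], because [0 * 0 = 0] and the top is
    absorbing. *)
Lemma corner_separation x y :
  (forall p q, (\bot * p * x * q * \bot == \bot) = (\bot * p * y * q * \bot == \bot)) -> x = y.
Proof.
pose c x y := forall p q, (\bot * p * x * q * \bot == \bot) = (\bot * p * y * q * \bot == \bot).
have [cE|cF] : (forall x y, c x y -> x = y) \/ (forall x y, c x y).
- apply: (simple_cases Hmul); split=> // [u v uv p q|u v w uv vw p q|u v w uv p q|u v w uv].
  + by rewrite uv.
  + by rewrite uv.
  + by rewrite !mUr !mUl !join_eq0 uv.
  split=> p q; first by have := uv (p * w) q; rewrite !mA.
  by have := uv p (w * q); rewrite !mA.
- exact: cE.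
by have := cF \bot \top \bot \bot; rewrite !bb rT !Tr eqxx eq_sym (negPf neq01).
Qed.

(** If [0 * x * 0] is nonzero, then every [0 * p * (0 * x * 0) * q * 0] lies above it and is nonzero
    too; so it passes the same tests as the top. *)
Lemma cornerP x : \bot * x * \bot = \bot \/ \bot * x * \bot = \top.
Proof.
have [->|h0] := eqVneq (\bot * x * \bot) \bot; first by left.
right; apply: corner_separation => p q; rewrite rT !Tr [RHS]eq_sym (negPf neq01).
apply: contraNF h0 => h; rewrite -lex0 -[X in _ <= X](eqP h).
have : \bot * \bot * (\bot * x * \bot) * \bot * \bot <= \bot * p * (\bot * x * \bot) * q * \bot.
  by apply/ler/(le_mul Hmul); [apply/ler/lel|]; apply: le0x.
by rewrite !mA !bb -!(mA _ \bot) !bb.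
Qed.

Lemma corner_ideal n m : m * \bot = m -> \bot * n * m = \bot \/ \bot * n * m = \top.
Proof. by move=> mM; rewrite -mM mA -(mA \bot n m); apply: cornerP. Qed.

Lemma bot_mul_top m : m * \bot = m -> \bot * m = \top -> m = \top.
Proof.
move=> mM m1; apply: corner_separation => p q; rewrite rT !Tr.
suff -> : \bot * p * m = \top by rewrite !Tr.
by apply/eqP; rewrite -le1x -m1; apply: ler; rewrite -{1}bb; apply/lel/le0x.
Qed.

(** For [y] in [R * 0] the test value is [(0 * p * y) * (0 * q * 0)], whose second factor is [0] or
    [1]. Only the left annihilator condition remains, and it cannot tell [a] from [a \/ x]. *)
Lemma corner_le a x : a * \bot = a -> x * \bot = x ->
  (forall p, \bot * p * a = \bot -> \bot * p * x = \bot) -> x <= a.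
Proof.
move=> aM xM ax; suff -> : a = a `|` x by apply: leUr.
apply: corner_separation => p q.
have e y : y * \bot = y -> \bot * p * y * q * \bot = \bot * p * y * (\bot * q * \bot).
  by move=> yM; rewrite -{1}yM !mA.
rewrite !e ?mUl ?aM ?xM //; case: (cornerP q) => ->; last by rewrite !rT.
rewrite -!mA mUl aM xM mUr mUr join_eq0 !mA.
by case: eqP => // /ax ->; rewrite eqxx.
Qed.

Lemma simple_idempotent_JM1 :
  exists (d : Order.disp_t) (L : finTBLatticeType d) (S : {set {ffun L -> L}}),
         [/\ (1 < #|L|)%N, top_join_irreducible (L := L),
             subsemiring is_JM1 S, iso_to_maps Order.join mul S &
             (forall a b : L, a != \top -> f_map a b \in S) /\
             (forall f, f \in S -> exists a b : L, a != \top /\ fle (f_map a b) f)].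
Proof.
exists (Order.Disp tt tt), L, S.
have PT : P \top by rewrite /P Tr.
have vT : val \top = \top.
  apply/eqP; rewrite -le1x -(lat_eltK joinA joinC joinxx Pb Pj jb PT).
  by rewrite -[lat_val _]/(val _) -val_le lex1.
(* An element of [L] differs from the top exactly when left multiplication by [0] kills it; this
   condition passes to joins, hence join-irreducibility. *)
have neT a : a != \top -> \bot * val a = \bot.
  move=> a1; have [] := corner_ideal \bot (valP a); rewrite bb // => a2; case/eqP: a1.
  by apply: lat_val_inj; rewrite -!/(val _) vT; apply: bot_mul_top.
have neT' a : \bot * val a = \bot -> a != \top.
  by apply: contra_eqN => /eqP ->; rewrite vT rT eq_sym neq01.
split=> //.
- by move=> a b /neT a0 /neT b0; apply: neT'; rewrite /val lat_valU mUr -!/(val _) a0 b0 joinxx.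
- apply: (lat_maps_subsemiring actD actM \bot) => r; split; first exact: lat_map_JM.
  by apply: lat_val_inj; rewrite lat_mapE -/(val _) vT rT.
split=> [a b a1|f /imsetP[r _ ->]].
  (* With [F] the greatest [p] such that [0 * p * a = 0], the product [0 * F * x] is [0] for
     [x <= a] and [1] otherwise. Multiplying by [b] on the left gives [f_{a,b}]. *)
  pose F := \join_(p | \bot * p * val a == \bot) p.
  have Fa : \bot * F * val a = \bot.
    apply/eqP; apply: (big_ind (fun p => \bot * p * val a == \bot)) => //.
      by rewrite bb neT.
    by move=> p q /eqP pa /eqP qa; rewrite mUr mUl pa qa joinxx.
  apply: (@memS (val b * (\bot * F))) => x; rewrite ffunE; case: ifPn => xa.
    suff e : \bot * F * val x = \bot by rewrite -mA e valP.
    by apply/eqP; rewrite -lex0 -[X in _ <= X]Fa; apply: lel; rewrite -val_le.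
  have [e|e] := corner_ideal F (valP x); last by rewrite -mA e rT vT.
  case/negP: xa; rewrite val_le; apply: corner_le => // p pa.
  apply/eqP; rewrite -lex0 -[X in _ <= X]e.
  by apply/ler/lel; apply: (le_bigjoin (P := fun p => \bot * p * val a == \bot)); apply/eqP.
(* For [x] not below this greatest [m] with [0 * m = 0], already [0 * x = 1], so every [r * x] is
   the top. *)
pose a : L := \join_(m : L | \bot * val m == \bot) m.
exists a, \bot; split.
  apply/neT'/eqP; apply: (big_ind (fun m => \bot * val m == \bot)) => //.
  by move=> m n /eqP m0 /eqP n0; rewrite /val lat_valU mUr -!/(val _) m0 n0 joinxx.
move=> x; rewrite ffunE; case: ifPn => xa; first exact: le0x.
rewrite val_le vT /val lat_mapE -/(val x).
have [e|<-] := corner_ideal \bot (valP x); last by rewrite bb; apply/ler/le0x.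
case/negP: xa; apply: (le_bigjoin (P := fun m : L => \bot * val m == \bot)).
by rewrite -{1}bb e.
Qed.

End BothSides.
End LeftIdealOfBottom.
End SimpleIdempotentCases.

(** * Representation on the ideals of the right ideal generated by the least element *)

Section RightIdealOfBottom.
Context {disp : Order.disp_t} {R : finTBLatticeType disp}.
Variable mul : R -> R -> R.
Hypothesis Hmul : simple_idempotent mul.
Local Notation "x * y" := (mul x y).

Let mA : associative mul. Proof. by case: Hmul. Qed.
Let mUr x y w : x * (y `|` w) = x * y `|` x * w. Proof. by case: Hmul. Qed.
Let mUl x y w : (x `|` y) * w = x * w `|` y * w. Proof. by case: Hmul. Qed.
Let bb : \bot * \bot = \bot. Proof. exact: mul_bot_bot Hmul. Qed.
Let lel w x y : x <= y -> w * x <= w * y. Proof. exact: (le_mull Hmul). Qed.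
Let ler w x y : x <= y -> x * w <= y * w. Proof. exact: (le_mulr Hmul). Qed.

Hypothesis bot_right_absorbing : forall r, r * \bot = \bot.
Hypothesis bot_not_left_absorbing : exists r, \bot * r <> \bot.

Let N : {set R} := [set x | \bot * x == x].
Let NP x : x \in N -> \bot * x = x. Proof. by rewrite inE => /eqP. Qed.
Let Nr x r : x \in N -> x * r \in N. Proof. by move=> /NP xN; rewrite inE mA xN. Qed.
Let Nl x r : x \in N -> r * x = x.
Proof. by move=> /NP xN; rewrite -xN mA bot_right_absorbing. Qed.
Let N0 : \bot \in N. Proof. by rewrite inE bb. Qed.
Let NU x y : x \in N -> y \in N -> x `|` y \in N.
Proof. by move=> /NP xN /NP yN; rewrite inE mUr xN yN. Qed.

(* The ideals of [N], including the empty one, ordered by reverse inclusion. *)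
Let P : pred {set R} := fun X =>
  (X \subset N) && [forall x in N, forall y in N, (x `|` y \in X) == (x \in X) && (y \in X)].
Let PP (X : {set R}) :
  reflect (X \subset N /\ {in N &, forall x y, (x `|` y \in X) = (x \in X) && (y \in X)})
          (P X).
Proof.
apply: (iffP andP) => -[XN XU]; split=> //.
  by move=> x y xN yN; have /forall_inP/(_ x xN)/forall_inP/(_ y yN)/eqP := XU.
by apply/forall_inP => x xN; apply/forall_inP => y yN; rewrite XU.
Qed.
Let P_down (X : {set R}) x y : P X -> x \in N -> x <= y -> y \in X -> x \in X.
Proof.
move=> /PP[XN XU] xN /join_r xy yX; move: (yX); rewrite -xy XU ?(subsetP XN y) //.
by case/andP.
Qed.
Let P0 (X : {set R}) x : P X -> x \in X -> \bot \in X.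
Proof. by move=> PX; apply: P_down => //; apply: le0x. Qed.
Let pr n : {set R} := [set x in N | x <= n].
Let in_pr n x : (x \in pr n) = (x \in N) && (x <= n). Proof. by rewrite in_set. Qed.
Let P_pr n : P (pr n).
Proof.
apply/PP; split=> [|x y xN yN]; first by apply/subsetP => x; rewrite in_pr => /andP[].
by rewrite !in_pr NU // xN yN leUx.
Qed.
(** By finiteness a nonempty ideal contains the join of its elements, so it is principal. *)
Let P_max (X : {set R}) x : P X -> x \in X -> exists2 n, n \in N & X = pr n.
Proof.
move=> PX xX; have [XN XU] := PP _ PX.
have nX : \join_(x in X) x \in X.
  elim/big_ind: _ => // [|u v uX vX]; first exact: P0 xX.
  by rewrite XU ?uX ?(subsetP XN).
exists (\join_(x in X) x); first exact: (subsetP XN).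
apply/setP => y; rewrite in_pr; apply/idP/andP => [yX|[yN /P_down]]; last exact.
by split; [apply: (subsetP XN)|apply: (le_bigjoin (P := fun y => y \in X))].
Qed.

(** Taking preimages under right multiplication turns the right action on [N] into a left action on
    its ideals. *)
Let act r (X : {set R}) : {set R} := [set x in N | x * r \in X].
Let in_act r X x : (x \in act r X) = (x \in N) && (x * r \in X). Proof. by rewrite in_set. Qed.
Let PN : P N. Proof. by apply/PP; split=> // x y xN yN; rewrite NU ?xN. Qed.
Let PI (X Y : {set R}) : P X -> P Y -> P (X :&: Y).
Proof.
move=> /PP[XN XU] /PP[YN YU]; apply/PP; split=> [|x y xN yN]; first by rewrite subIset ?XN.
by rewrite !in_setI XU // YU // andbACA.
Qed.
Let NI (X : {set R}) : P X -> N :&: X = X. Proof. by move=> /PP[XN _]; apply/setIidPr. Qed.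
Let Pact r X : P X -> P (act r X).
Proof.
move=> /PP[XN XU]; apply/PP; split=> [|x y xN yN].
  by apply/subsetP => x; rewrite in_act => /andP[].
by rewrite !in_act NU // xN yN mUl XU ?Nr.
Qed.
Let actD r s X : P X -> act (r `|` s) X = act r X :&: act s X.
Proof.
move=> /PP[XN XU]; apply/setP => x; rewrite in_setI !in_act; case: (boolP (x \in N)) => //= xN.
by rewrite mUr XU // Nr.
Qed.
Let actM r s X : P X -> act (r * s) X = act r (act s X).
Proof.
move=> _; apply/setP => x; rewrite !in_act; case: (boolP (x \in N)) => //= xN.
by rewrite Nr //= mA.
Qed.
Let actJ r (X Y : {set R}) : P X -> P Y -> act r (X :&: Y) = act r X :&: act r Y.
Proof. by move=> _ _; apply/setP => x; rewrite in_setI !in_act in_setI; case: (x \in N). Qed.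
(** Testing on the principal ideal below [t * u] gives [t * v <= t * u]. By symmetry [r] and [s]
    agree after left multiplication by elements of [0 * R], which is faithful. *)
Let act_faithful r s : (forall X, P X -> act r X = act s X) -> r = s.
Proof.
move=> rs.
have le t u v : t \in N -> (forall X, P X -> act u X = act v X) -> t * v <= t * u.
  move=> tN uv; have /uv/setP/(_ t) := P_pr (t * u).
  by rewrite !in_act tN !in_pr !Nr // lexx => /esym.
apply: (left_ideal_faithful (simple_idempotent_op Hmul)) => // t.
have tN : \bot * t \in N by apply: Nr.
by apply: le_anti; rewrite !le // => X PX; rewrite rs.
Qed.

Let setIidem (X : {set R}) : X :&: X = X. Proof. exact: setIid. Qed.
Let L := semimodule_lattice (@setIA R) (@setIC R) setIidem PN PI NI.
Let val (X : L) : {set R} := lat_val X.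
Let S := lat_maps (@setIA R) (@setIC R) setIidem PN PI NI Pact.
Let elt (X : {set R}) (PX : P X) : L := lat_elt (@setIA R) (@setIC R) setIidem PN PI NI PX.
Let val_le (X Y : L) : (X <= Y) = (val Y \subset val X).
Proof. by rewrite lat_le; apply/eqP/setIidPr. Qed.
Let valP (X : L) : P (val X). Proof. exact: (lat_valP X). Qed.
Let memS r (f : {ffun L -> L}) : (forall X, val (f X) = act r (val X)) -> f \in S.
Proof. exact: mem_lat_maps. Qed.
Let Pset0 : P set0. Proof. by apply/PP; split=> [|x y _ _]; rewrite ?sub0set ?inE. Qed.
Let valT : val \top = set0.
Proof. by apply/eqP; rewrite -subset0 -[set0]/(val (elt Pset0)) -val_le lex1. Qed.
Let neT (X : L) : X != \top -> exists2 n, n \in N & val X = pr n.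
Proof.
move=> X1; have /set0Pn[x xX] : val X != set0.
  by rewrite -valT (inj_eq (@lat_val_inj _ _ _ _ _ _ _ _ _ _)).
exact: P_max xX.
Qed.
Let bot_in (X : L) : (X != \top) = (\bot \in val X).
Proof.
apply/idP/idP => [/neT[n _ ->]|]; first by rewrite in_pr N0 le0x.
by apply: contraTneq => ->; rewrite valT inE.
Qed.

Lemma simple_idempotent_Res1 :
  exists (d : Order.disp_t) (L : finTBLatticeType d) (S : {set {ffun L -> L}}),
         [/\ (2 < #|L|)%N, top_join_irreducible (L := L),
             subsemiring is_Res1 S, iso_to_maps Order.join mul S &
             [/\ (forall a : L, a != \top -> f_map a \bot \in S),
                 (forall f, f \in S -> exists2 a : L, a != \top & fle (f_map a \bot) f) &
                 (forall a b : L, a != \bot -> a != \top ->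
                     exists2 f, f \in S & f a = b)]].
Proof.
exists (Order.Disp tt tt), L, S.
have act0 r : act r set0 = set0 by apply/setP => x; rewrite in_act !inE andbF.
have actN r : act r N = N by apply/setP => x; rewrite in_act andb_idr // => /Nr.
(* Since [x * n = n], an element [n] of [N] acts with the two values bottom ([N]) and top (the empty
   ideal); it realizes [f_{a,0}] for the principal ideal [a] below [n]. *)
have act_l n (X : {set R}) : P X -> n \in N -> act n X = if n \in X then N else set0.
  move=> PX nN; apply/setP => x; rewrite in_act Nl //.
  by case: (n \in X); rewrite ?andbT ?andbF ?in_set0.
(* The ideal [{0}] is the greatest element below the top, since every nonempty ideal contains
   [0]. *)
pose z : L := elt (P_pr \bot).
have zE (X : L) : (X <= z) = (X != \top).
  rewrite bot_in val_le; apply/subsetP/idP => [|b0 x]; first by apply; rewrite in_pr N0 lexx.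
  by rewrite in_pr lex0 => /andP[_ /eqP ->].
have zT : z != \top by rewrite -zE.
split=> //.
- rewrite -(cardsT L); apply: leq_trans (_ : #|[set \bot; z; \top : L]| <= _)%N; last first.
    exact/subset_leq_card/subsetT.
  have zB : \bot != z.
    have [s sP] := bot_not_left_absorbing.
    apply: contra_not_neq sP => /(congr1 val)/setP/(_ (\bot * s)).
    by rewrite /val lat_val0 Nr // in_pr Nr // lex0 => /esym/eqP.
  have BT : \bot != \top :> L by rewrite -zE le0x.
  by rewrite setUC cardsU1 cards2 zB !inE negb_or ![\top == _]eq_sym BT zT.
- by move=> X Y; rewrite !bot_in /val lat_valU in_setI => -> ->.
- apply: (lat_maps_subsemiring actD actM \bot) => r; split; last first.
    by apply: lat_val_inj; rewrite lat_mapE -/(val _) valT act0.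
  split; first exact: lat_map_JM.
  by apply: lat_val_inj; rewrite lat_mapE lat_val0 actN.
- exact: lat_maps_iso actD actM act_faithful.
split=> [A /neT[n nN An]|f /imsetP[r _ ->]|A B A0 A1].
- apply: (@memS n) => X; rewrite ffunE act_l // val_le An.
  have -> : (pr n \subset val X) = (n \in val X).
    apply/subsetP/idP => [|nX x]; first by apply; rewrite in_pr nN lexx.
    by rewrite in_pr => /andP[xN xn]; apply: P_down nX.
  by case: ifP; rewrite ?valT.
- exists z; first exact: zT.
  move=> X; rewrite ffunE zE; case: eqP => [->|_]; last exact: le0x.
  by rewrite val_le {1}/val lat_mapE -/(val _) valT act0 sub0set.
have [n1 n1N n1A] : exists2 n, n \in N & n \notin val A.
  apply/subsetPn; apply: contraNN A0 => NA; apply/eqP/le_anti; rewrite le0x andbT val_le.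
  by [].
have [->|/neT[b bN Bb]] := eqVneq B \top.
  exists (lat_map (@setIA R) (@setIC R) setIidem PN PI NI Pact n1); first exact: imset_f.
  by apply: lat_val_inj; rewrite lat_mapE -!/(val _) valT act_l // (negPf n1A).
have [AN AU] := PP _ (valP A).
(* [F] is the greatest [r] with [b * r] in [A]. If [x * F] is in [A], then [b * r \in A] implies
   [x * r \in A], and separation in the opposite semiring gives [x <= b]; thus [F] sends [A] to the
   ideal below [b]. *)
pose F := \join_(r | b * r \in val A) r.
have bF : b * F \in val A.
  apply: (big_ind (fun r => b * r \in val A)) => // [|r s rA sA].
    by rewrite bot_right_absorbing -bot_in.
  by rewrite mUr AU ?Nr // rA.
exists (lat_map (@setIA R) (@setIC R) setIidem PN PI NI Pact F); first exact: imset_f.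
apply: lat_val_inj; rewrite lat_mapE -!/(val _) Bb; apply/setP => x; rewrite in_act in_pr.
case: (boolP (x \in N)) => //= xN; apply/idP/idP => [xF|xb]; last first.
  by apply: P_down bF; rewrite ?Nr //; apply: ler.
apply: (@left_zero_separation _ _ _ (simple_idempotent_op Hmul) (mem (val A)) _ _ \bot n1).
- exact: bot_right_absorbing.
- exact: NP.
- exact: NP.
- exact: bb.
- exact: NP.
- by move=> u v uN vN; apply: AU; rewrite inE.
- by rewrite -bot_in.
- by [].
move=> r rb; apply: P_down xF; rewrite ?Nr //; apply: lel.
exact: (le_bigjoin (P := fun r => b * r \in val A)).
Qed.

End RightIdealOfBottom.

(** * Representation on a minimal left ideal when the least element is absorbing *)

Section AbsorbingBottom.
Context {disp : Order.disp_t} {R : finTBLatticeType disp}.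
Variable mul : R -> R -> R.
Hypothesis Hmul : simple_idempotent mul.
Local Notation "x * y" := (mul x y).

Let mA : associative mul. Proof. by case: Hmul. Qed.
Let mUr x y w : x * (y `|` w) = x * y `|` x * w. Proof. by case: Hmul. Qed.
Let mUl x y w : (x `|` y) * w = x * w `|` y * w. Proof. by case: Hmul. Qed.
Let ler w x y : x <= y -> x * w <= y * w. Proof. exact: (le_mulr Hmul). Qed.

Hypothesis mulx0 : forall r, r * \bot = \bot.
Hypothesis mul0x : forall r, \bot * r = \bot.

Section MinimalLeftIdeal.
Variable x0 : R.
Hypothesis x0_neq0 : x0 != \bot.
Hypothesis x0_min : forall r, r * x0 != \bot -> forall s, exists t, s * x0 = t * (r * x0).

Let t := \top * x0.
Let t_neq0 : t != \bot.
Proof.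
apply: contraNneq x0_neq0 => t0; apply/eqP/(mulr_faithful Hmul) => r.
by apply/eqP; rewrite mulx0 -lex0 -t0; apply/ler/lex1.
Qed.

Let ann (y : R) : {set R} := [set r | r * y == \bot].
Let in_ann y r : (r \in ann y) = (r * y == \bot). Proof. by rewrite inE. Qed.
Let annU x y : ann (x `|` y) = ann x :&: ann y.
Proof. by apply/setP => r; rewrite !inE mUr join_eq0. Qed.
Let ann0 : ann \bot = setT. Proof. by apply/setP => r; rewrite !inE mulx0 eqxx. Qed.

(* The lattice is the quotient of the minimal left ideal [R * x0] identifying elements with equal
   annihilators; each class is represented by its annihilator. *)
Let P : pred {set R} := fun X => [exists r, X == ann (r * x0)].
Let P_ann r : P (ann (r * x0)). Proof. by apply/existsP; exists r. Qed.
Let PP X : P X -> exists r, X = ann (r * x0). Proof. by move=> /existsP[r /eqP ->]; exists r. Qed.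
Let act s (X : {set R}) : {set R} := [set r | r * s \in X].
Let act_ann s y : act s (ann y) = ann (s * y).
Proof. by apply/setP => r; rewrite !inE mA. Qed.
Let PT : P setT. Proof. by rewrite -ann0 -(mul0x x0); apply: P_ann. Qed.
Let PI (X Y : {set R}) : P X -> P Y -> P (X :&: Y).
Proof. by move=> /PP[r ->] /PP[s ->]; rewrite -annU -mUl. Qed.
Let TI (X : {set R}) : P X -> setT :&: X = X. Proof. by rewrite setTI. Qed.
Let Pact r X : P X -> P (act r X).
Proof. by move=> /PP[s ->]; rewrite act_ann mA. Qed.
Let actD r s X : P X -> act (r `|` s) X = act r X :&: act s X.
Proof. by move=> /PP[u ->]; rewrite !act_ann mUl annU. Qed.
Let actM r s X : P X -> act (r * s) X = act r (act s X).
Proof. by move=> /PP[u ->]; rewrite !act_ann -mA. Qed.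
Let actJ r (X Y : {set R}) : P X -> P Y -> act r (X :&: Y) = act r X :&: act r Y.
Proof. by move=> /PP[u ->] /PP[v ->]; rewrite -annU !act_ann mUr annU. Qed.
(** If equality of all these annihilators were the full congruence, comparison with [0] would make
    every product [y * r * u * x0] vanish; three uses of faithfulness then give [x0 = 0]. *)
Let act_faithful r s : (forall X, P X -> act r X = act s X) -> r = s.
Proof.
pose q r s := forall u, ann (r * (u * x0)) = ann (s * (u * x0)).
have [qE|qF] : (forall x y, q x y -> x = y) \/ (forall x y, q x y).
- apply: (simple_cases Hmul); split=> // [u v uv y|u v w uv vw y|u v w uv y|u v w uv].
  + by rewrite uv.
  + by rewrite uv.
  + by rewrite !mUl !annU uv.
  by split=> y; [rewrite -!mA -!(act_ann w) uv|rewrite -!mA (mA w) uv].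
- by move=> rs; apply: qE => u; rewrite -!(act_ann _ (u * x0)) rs.
case/eqP: x0_neq0; do 3![apply: (mulr_faithful Hmul) => ?; rewrite mulx0].
by apply/eqP; rewrite -in_ann (qF _ \bot) mul0x ann0 inE.
Qed.

Let setIidem (X : {set R}) : X :&: X = X. Proof. exact: setIid. Qed.
Let L := semimodule_lattice (@setIA R) (@setIC R) setIidem PT PI TI.
Let val (X : L) : {set R} := lat_val X.
Let S := lat_maps (@setIA R) (@setIC R) setIidem PT PI TI Pact.
Let val_le (X Y : L) : (X <= Y) = (val Y \subset val X).
Proof. by rewrite lat_le; apply/eqP/setIidPr. Qed.
Let valP (X : L) : exists r, val X = ann (r * x0).
Proof. have := lat_valP X; exact: PP. Qed.
Let memS r (f : {ffun L -> L}) : (forall X, val (f X) = act r (val X)) -> f \in S.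
Proof. exact: mem_lat_maps. Qed.

Lemma minimal_left_ideal_Res :
  exists (d : Order.disp_t) (L : finTBLatticeType d) (S : {set {ffun L -> L}}),
         [/\ subsemiring is_Res S, iso_to_maps Order.join mul S &
             (forall a b : L, e_map a b \in S)].
Proof.
exists (Order.Disp tt tt), L, S; split.
- apply: (lat_maps_subsemiring actD actM \bot) => r; split; first exact: lat_map_JM.
  by apply: lat_val_inj; rewrite lat_mapE lat_val0 -ann0 act_ann mulx0.
- exact: lat_maps_iso actD actM act_faithful.
move=> A B; have [[a Aa] [b Bb]] := (valP A, valP B).
(* The map [e_{A,B}] is the action of [c * F], where [b * x0 = c * t]. For [X = ann (x * x0)], the
   product [F * x * x0] is [0] when [X <= A] and the greatest element [t] of the left ideal
   otherwise. *)
pose F := \join_(r | r * (a * x0) == \bot) r.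
have F_max r : r * (a * x0) = \bot -> r <= F.
  by move=> ra; apply: (le_bigjoin (P := fun r => r * (a * x0) == \bot)); apply/eqP.
have Fa : F * (a * x0) = \bot.
  apply/eqP; apply: (big_ind (fun r => r * (a * x0) == \bot)) => //.
    by rewrite mul0x.
  by move=> r s /eqP ra /eqP sa; rewrite mUl ra sa joinxx.
have [c bc] := x0_min t_neq0 b.
apply: (@memS (c * F)) => X; rewrite ffunE val_le Aa.
have [x ->] := valP X; rewrite act_ann.
case: ifPn => [/subsetP AX|AX].
  suff -> : c * F * (x * x0) = \bot by rewrite /val lat_val0 ann0.
  suff : F \in ann (x * x0) by rewrite in_ann -mA => /eqP ->; rewrite mulx0.
  by apply: AX; rewrite in_ann Fa.
rewrite Bb bc -mA; congr (ann (c * _)).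
have Fx0 : F * x * x0 != \bot.
  apply: contraNneq AX => Fx; apply/subsetP => r; rewrite !in_ann => /eqP/F_max rF.
  by rewrite -lex0 -Fx -mA; apply: ler.
(* [R * F <= F], so [F * x * x0] is the greatest element of [R * (F * x * x0) = R * x0]. *)
rewrite mA; apply: le_anti; rewrite [X in _ && X]ler ?lex1 // andbT.
have [u tu] := x0_min Fx0 \top; rewrite /t tu !mA; do 2!apply: ler.
by apply: F_max; rewrite -mA Fa mulx0.
Qed.

End MinimalLeftIdeal.

Lemma simple_idempotent_Res :
  exists (d : Order.disp_t) (L : finTBLatticeType d) (S : {set {ffun L -> L}}),
         [/\ subsemiring is_Res S, iso_to_maps Order.join mul S &
             (forall a b : L, e_map a b \in S)].
Proof.
have top0 : \top != \bot :> R by rewrite eq_sym (neq_bot_top Hmul).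
have [x x0 xmin] := exists_minimal_left_ideal mA top0.
exact: minimal_left_ideal_Res x0 xmin.
Qed.

End AbsorbingBottom.

(** * Finite simple rings *)

Local Open Scope ring_scope.

(** * Jacobson density and matrix coordinates *)

Section Density.
Variables (R : finZmodType) (mul : R -> R -> R).
Variables (F : finFieldType) (V : lmodType F) (act : R -> V -> V) (sV : seq V).
Hypothesis mem_sV : forall v, v \in sV.
Hypothesis actDl : forall r s v, act (r + s) v = act r v + act s v.
Hypothesis actDr : forall r u v, act r (u + v) = act r u + act r v.
Hypothesis actM : forall r s v, act (mul r s) v = act r (act s v).
Hypothesis actZ : forall r a v, act r (a *: v) = a *: act r v.
Hypothesis act_faithful : forall r s, (forall v, act r v = act s v) -> r = s.
Hypothesis act_irr : forall v w : V, v != 0 -> exists r, act r v = w.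
Hypothesis commutant_scalar : forall f : V -> V,
  (forall u v, f (u + v) = f u + f v) -> (forall r v, f (act r v) = act r (f v)) ->
  exists a, forall v, f v = a *: v.
Variable v0 : V.
Hypothesis v0_neq0 : v0 != 0.

Let act0 r : act r 0 = 0. Proof. by apply: (addIr (act r 0)); rewrite -actDr !add0r. Qed.
Let act0l v : act 0 v = 0. Proof. by apply: (addIr (act 0 v)); rewrite -actDl !add0r. Qed.
Let actN r v : act r (- v) = - act r v. Proof. by rewrite -scaleN1r actZ scaleN1r. Qed.
Let actNl r v : act (- r) v = - act r v.
Proof. by apply: (addIr (act r v)); rewrite -actDl !addNr act0l. Qed.

Fixpoint seq_span (s : seq V) (v : V) : Prop :=
  if s is x :: s' then exists a, seq_span s' (v - a *: x) else v = 0.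

Lemma seq_span0 s : seq_span s 0.
Proof. by elim: s => //= x s IH; exists 0; rewrite scale0r subr0. Qed.

Lemma seq_spanD s u v : seq_span s u -> seq_span s v -> seq_span s (u + v).
Proof.
elim: s u v => /= [u v -> ->|x s IH u v [a ua] [b vb]]; first by rewrite addr0.
by exists (a + b); rewrite scalerDl opprD addrACA; apply: IH.
Qed.

Lemma seq_spanZ s c v : seq_span s v -> seq_span s (c *: v).
Proof.
elim: s v => /= [v ->|x s IH v [a va]]; first by rewrite scaler0.
by exists (c * a); rewrite -scalerA -scalerBr; apply: IH.
Qed.

Lemma mem_seq_span s v : v \in s -> seq_span s v.
Proof.
elim: s => //= x s IH; rewrite inE => /orP[/eqP ->|vs].
  by exists 1; rewrite scale1r subrr; apply: seq_span0.
by exists 0; rewrite scale0r subr0; apply: IH.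
Qed.

Lemma seq_span_cat s1 x s2 v : seq_span (s1 ++ x :: s2) v ->
  exists a, seq_span (s1 ++ s2) (v - a *: x).
Proof.
elim: s1 v => //= y s1 IH v [b /IH[a va]]; exists a, b.
by rewrite addrAC.
Qed.

(** Induction on [s], by contradiction: if all elements killing [x :: s] kill [v], then those
    killing [s] kill [v - a *: x] for some scalar [a], and the induction hypothesis puts this vector
    in the span of [s]. *)
Lemma density s v : ~ seq_span s v ->
  exists2 r, {in s, forall x, act r x = 0} & act r v != 0.
Proof.
elim: s v => [|x s IH] v.
  by move=> /eqP /= v1; have [r rv] := act_irr v0 v1; exists r; rewrite ?rv.
move=> nv; apply: NNPP => nr; apply: nv.
pose A r := {in s, forall x, act r x = 0}.
have H r : A r -> act r x = 0 -> act r v = 0.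
  move=> Ar rx; apply/eqP/negP => /negP rv; apply: nr; exists r => // y.
  by rewrite inE => /orP[/eqP ->|/Ar].
have Hspan w : (forall r, A r -> act r w = 0) -> seq_span s w.
  move=> Aw; apply: NNPP => /IH[r Ar]; case/negP; apply/eqP; exact: Aw.
have [/existsP[r1 /andP[/allP r1A r1x]]|/existsPn rx] :=
  boolP [exists r, all (fun x => act r x == 0) s && (act r x != 0)]; last first.
  exists 0; rewrite scale0r subr0; apply: Hspan => r Ar; apply: H => //.
  apply/eqP; have := rx r; rewrite negb_and negbK => /orP[|//]; case/negP.
  by apply/allP => y /Ar/eqP.
have {}r1A : A r1 by move=> y /r1A/eqP.
(* The annihilator of [s] moves [x] everywhere, so [r x |-> r v] is an endomorphism. *)
have Ax w : exists2 r, [forall y : 'I_(size s), act r s`_y == 0] & act r x = w.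
  have [t tw] := act_irr w r1x; exists (mul t r1); last by rewrite actM.
  by apply/forallP => i; rewrite actM r1A ?act0 // mem_nth.
(* By [Ax] some [r] is always found, so the default 0 never occurs; by [H] the value at [v] does not
   depend on the choice. *)
pose good w := [pred r | [forall y : 'I_(size s), act r s`_y == 0] && (act r x == w)].
pose f w := act (odflt 0 [pick r in good w]) v.
have AP r : [forall y : 'I_(size s), act r s`_y == 0] -> A r.
  move=> /forallP Ar y /(nthP 0)[i si <-]; exact/eqP/(Ar (Ordinal si)).
have fE r : A r -> f (act r x) = act r v.
  move=> Ar; rewrite /f; case: pickP => [r'|] /=; last first.
    have [r' r'A r'x] := Ax (act r x) => /(_ r'); rewrite !inE r'A r'x eqxx.
    by [].
  rewrite inE => /andP[/AP r'A /eqP r'x].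
  apply/eqP; rewrite -subr_eq0 -actNl -actDl; apply/eqP/H.
    by move=> y ys; rewrite actDl actNl r'A // Ar // subr0.
  by rewrite actDl actNl r'x subrr.
have [|r w|a fa] := commutant_scalar (f := f).
- move=> u w; have [[r /AP rA <-] [t /AP tA <-]] := (Ax u, Ax w).
  rewrite -actDl !fE ?actDl // => y ys; by rewrite actDl rA // tA // addr0.
- have [t /AP tA <-] := Ax w; rewrite -actM !fE ?actM // => y ys.
  by rewrite actM tA // act0.
exists a; apply: Hspan => r Ar.
by rewrite actDr actN actZ -fa fE // subrr.
Qed.

Definition independent (s : seq V) : Prop :=
  forall s1 x s2, s = s1 ++ x :: s2 -> ~ seq_span (s1 ++ s2) x.

(** Redundant entries are deleted from a list of all vectors until none is left; each deletion
    preserves the span. *)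
Lemma exists_basis : exists2 s, (forall v, seq_span s v) & independent s.
Proof.
have : forall v, seq_span sV v by move=> v; apply/mem_seq_span/mem_sV.
move: {2}(size sV) (leqnn (size sV)) => n; elim: n sV => [|n IH] s sn sP.
  by exists s => // s1 x s2 s0; move: sn; rewrite s0 size_cat addnS.
have [|/not_all_ex_not[s1 /not_all_ex_not[x /not_all_ex_not[s2 s12]]]] :=
  classic (independent s); first by exists s.
have [sE /NNPP xs] := imply_to_and _ _ s12.
apply: (IH (s1 ++ s2)); first by move: sn; rewrite sE !size_cat /= addnS.
move=> v; have := sP v; rewrite sE => /seq_span_cat[a va].
by rewrite -(subrK (a *: x) v); apply: seq_spanD => //; apply: seq_spanZ.
Qed.

Lemma density_matrix_iso : exists n, (0 < n)%N /\
  semiring_iso +%R mul (fun A B : 'M[F]_n => A + B) (fun A B : 'M[F]_n => A *m B).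
Proof.
have [s sspan sind] := exists_basis; pose n := size s; pose e (i : 'I_n) := s`_i.
have span_sum (v : V) : exists A : 'rV[F]_n, v == \sum_i A 0 i *: e i.
  (* Coefficients indexed by [nat] can be shifted when the list grows at its head. *)
  have : exists c : nat -> F, v = \sum_(i < n) c i *: s`_i.
    have := sspan v; rewrite /n; elim: s v {sspan sind n e} => [v /= ->|x s IH v /= [a /IH[c vc]]].
      by exists (fun=> 0); rewrite big_ord0.
    exists (fun i => if i is i'.+1 then c i' else a); rewrite big_ord_recl /= -vc.
    by rewrite addrC subrK.
  move=> [c ->]; exists (\row_i c i); apply/eqP; apply: eq_bigr => i _; by rewrite mxE.
(* Density yields an element that kills the other basis vectors but not [e i]; irreducibility then
   moves the image of [e i] to [w]. *)
have delta (i : 'I_n) w : exists r, [forall k, act r (e k) == if k == i then w else 0].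
  have [|r r0 ri] := @density (take i s ++ drop i.+1 s) (e i).
    by apply: sind; rewrite -drop_nth ?cat_take_drop.
  have [t tw] := act_irr w ri; exists (mul t r); apply/forallP => k; rewrite actM.
  case: (eqVneq k i) => [->|ki]; first by rewrite tw.
  rewrite r0 ?act0 // mem_cat; move: ki; rewrite -val_eqE neq_ltn => /orP[] ki.
    by rewrite /e -(nth_take _ ki) mem_nth // size_take ltn_ord.
  have kn := ltn_ord k : (\val k < size s)%N.
  by rewrite orbC /e -(subnKC ki) -nth_drop mem_nth // size_drop ltn_sub2r // (leq_ltn_trans ki).
have act_sum r (G : 'I_n -> V) : act r (\sum_i G i) = \sum_i act r (G i).
  exact: (big_morph (act r) (actDr r) (act0 r)).
have uniq_coord (A B : 'rV[F]_n) : \sum_i A 0 i *: e i = \sum_i B 0 i *: e i -> A = B.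
  move=> AB; apply/rowP => i; have [r /forallP rP] := delta i v0.
  have ev (C : 'rV[F]_n) : act r (\sum_i C 0 i *: e i) = C 0 i *: v0.
    rewrite act_sum (bigD1 i) //= big1 ?addr0 => [|k ki]; rewrite actZ (eqP (rP _)) ?eqxx //.
    by rewrite (negPf ki) scaler0.
  have : (A 0 i - B 0 i) *: v0 == 0 by rewrite scalerBl -!ev AB subrr.
  by rewrite scaler_eq0 (negPf v0_neq0) orbF subr_eq0 => /eqP.
pose coord (v : V) : 'rV[F]_n := odflt 0 [pick A : 'rV[F]_n | v == \sum_i A 0 i *: e i].
have coordK (v : V) : \sum_i coord v 0 i *: e i = v.
  rewrite /coord; case: pickP => [A /eqP //|]; have [A vA] := span_sum v.
  by move=> /(_ A); rewrite vA.
have sumK (A : 'rV[F]_n) : coord (\sum_i A 0 i *: e i) = A by apply: uniq_coord; rewrite coordK.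
have coordD u v : coord (u + v) = coord u + coord v.
  apply: uniq_coord; rewrite coordK; under eq_bigr do rewrite mxE scalerDl.
  by rewrite big_split /= !coordK.
pose phi r : 'M[F]_n := \matrix_(i, j) coord (act r (e j)) 0 i.
have phiE r j : act r (e j) = \sum_i phi r i j *: e i.
  by rewrite -[LHS]coordK; apply: eq_bigr => i _; rewrite mxE.
have phi_inj : injective phi.
  move=> r t rt; apply: act_faithful => v; rewrite -(coordK v) !act_sum.
  by apply: eq_bigr => i _; rewrite !actZ !phiE rt.
have phi_surj (A : 'M[F]_n) : exists r, phi r == A.
  pose w j := \sum_i A i j *: e i.
  (* [rho j] produces column [j] of [A] and kills the other basis vectors, so the sum over [j] has
     matrix [A]. *)
  pose rho j := odflt 0 [pick r | [forall k, act r (e k) == if k == j then w j else 0]].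
  have rhoE j k : act (rho j) (e k) = if k == j then w j else 0.
    rewrite /rho; case: pickP => [r /forallP/(_ k)/eqP //|]; have [r rP] := delta j (w j).
    by move=> /(_ r); rewrite rP.
  exists (\sum_j rho j); apply/eqP/matrixP => i j; rewrite mxE.
  rewrite (big_morph (act^~ (e j)) (fun r s => actDl r s _) (act0l _)).
  rewrite (bigD1 j) //= rhoE eqxx big1 ?addr0 => [|k kj]; last by rewrite rhoE eq_sym (negPf kj).
  have -> : w j = \sum_i (\row_i A i j) 0 i *: e i by apply: eq_bigr => k _; rewrite mxE.
  by rewrite sumK mxE.
exists n; split.
  rewrite lt0n; apply: contraNneq v0_neq0 => n0; rewrite -(coordK v0).
  by rewrite big1 // => -[i ip]; exfalso; move: ip; rewrite n0.
exists phi; split.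
  exists (fun A => odflt 0 [pick r | phi r == A]) => [r|A]; case: pickP => //=.
  - by move=> t /eqP/phi_inj.
  - by move=> /(_ r); rewrite eqxx.
  - by move=> t /eqP.
  by move=> H; have [r rA] := phi_surj A; rewrite H in rA.
move=> r t; split; apply/matrixP => i j; rewrite !mxE.
  by rewrite actDl coordD !mxE.
rewrite actM phiE act_sum.
have -> : \sum_k act r (phi t k j *: e k) = \sum_k (\row_k \sum_l phi r k l * phi t l j) 0 k *: e k.
  under eq_bigr => k _ do rewrite actZ phiE scaler_sumr.
  rewrite exchange_big /=; apply: eq_bigr => k _; rewrite mxE scaler_suml.
  by apply: eq_bigr => l _; rewrite scalerA mulrC.
by rewrite sumK mxE.
Qed.

End Density.

(** * Wedderburn's little theorem for explicitly given operations *)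

Section FiniteSkewField.
Variables (D : finType) (zero one : D) (opp : D -> D) (add mul : D -> D -> D).
Hypotheses (addA : associative add) (addC : commutative add).
Hypotheses (add0 : left_id zero add) (addN : left_inverse zero opp add).
Hypotheses (mulA : associative mul) (mul1x : left_id one mul) (mulx1 : right_id one mul).
Hypotheses (mulDl : left_distributive mul add) (mulDr : right_distributive mul add).
Hypothesis one_neq0 : one != zero.
Hypothesis mulV : forall x, x != zero -> exists y, mul y x = one /\ mul x y = one.

Lemma finite_skew_field : exists (F : finFieldType) (f : F -> D) (g : D -> F),
  [/\ cancel g f, f 1 = one, {morph f : x y / x + y >-> add x y} &
      {morph f : x y / x * y >-> mul x y}].
Proof.
pose Z : zmodType := HB.pack D (GRing.isZmodule.Build D addA addC add0 addN).
pose A : nzRingType := HB.pack D Z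
  (GRing.Zmodule_isNzRing.Build Z mulA mul1x mulx1 mulDl mulDr one_neq0).
pose unit : pred A := fun x => x != 0.
(* The default [x] makes [inv] the identity on the non-unit 0, the convention for rings with
   units. *)
pose inv (x : A) : A := odflt x [pick y : D | (mul y x == one) && (mul x y == one)].
have invP (x : A) : x != 0 -> inv x * x = 1 /\ x * inv x = 1.
  rewrite /inv => x0; case: pickP => [y /andP[/eqP yx /eqP xy] //|].
  by have [y [yx xy]] := mulV x0; move=> /(_ y); rewrite yx xy !eqxx.
have mulVr : {in unit, left_inverse 1 inv *%R} by move=> x /invP[].
have mulrV : {in unit, right_inverse 1 inv *%R} by move=> x /invP[].
have unitP (x y : A) : y * x = 1 /\ x * y = 1 -> unit x.
  move=> [yx _]; rewrite /unit; apply: contra_eqN yx => /eqP ->.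
  by rewrite mulr0 eq_sym oner_neq0.
have inv_out : {in [predC unit], inv =1 id}.
  move=> x; rewrite !inE negbK => /eqP ->; rewrite /inv; case: pickP => // y /andP[/eqP y0 _].
  by have /esym/eqP : (y : A) * 0 = 1 := y0; rewrite mulr0 oner_eq0.
pose B : finUnitRingType := HB.pack D Z A
  (GRing.NzRing_hasMulInverse.Build A mulVr mulrV unitP inv_out).
have B_domain : GRing.integral_domain_axiom B.
  move=> x y xy; apply: contraT; rewrite negb_or => /andP[x0 y0].
  have xV : (inv x : B) * x = 1 := proj1 (invP x x0).
  by case/eqP: y0; rewrite -[y]mul1r -xV -mulrA xy mulr0.
by exists (FinDomainFieldType B_domain), id, id.
Qed.
End FiniteSkewField.

(** * Schur's lemma and the commutant of an irreducible module *)

Section Commutant.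
Variables (R V : finZmodType) (mul : R -> R -> R) (act : R -> V -> V).
Hypothesis actDl : forall r s v, act (r + s) v = act r v + act s v.
Hypothesis actDr : forall r u v, act r (u + v) = act r u + act r v.
Hypothesis actM : forall r s v, act (mul r s) v = act r (act s v).
Hypothesis act_faithful : forall r s, (forall v, act r v = act s v) -> r = s.
Hypothesis act_irr : forall v w : V, v != 0 -> exists r, act r v = w.
Variable v0 : V.
Hypothesis v0_neq0 : v0 != 0.

Let act0 r : act r 0 = 0. Proof. by apply: (addIr (act r 0)); rewrite -actDr !add0r. Qed.

(** A Boolean predicate on finite functions makes the commutant a finite type, as Wedderburn's
    theorem requires. *)
Definition endo (f : {ffun V -> V}) : bool :=
  [forall u, forall v, f (u + v) == f u + f v] && [forall r, forall v, f (act r v) == act r (f v)].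

Lemma endoP (f : {ffun V -> V}) : reflect ((forall u v, f (u + v) = f u + f v) /\
                         (forall r v, f (act r v) = act r (f v))) (endo f).
Proof.
apply: (iffP andP) => -[H1 H2]; split.
- by move=> u v; apply/eqP; have /forallP/(_ u)/forallP/(_ v) := H1.
- by move=> r v; apply/eqP; have /forallP/(_ r)/forallP/(_ v) := H2.
- by apply/forallP => u; apply/forallP => v; rewrite H1.
by apply/forallP => r; apply/forallP => v; rewrite H2.
Qed.

Let D : finType := {f : {ffun V -> V} | endo f}.
Let ev (d : D) (v : V) : V := sval d v.
Let evD d u v : ev d (u + v) = ev d u + ev d v.
Proof. by have /endoP[H _] := svalP d; apply: H. Qed.
Let ev_act d r v : ev d (act r v) = act r (ev d v).
Proof. by have /endoP[_ H] := svalP d; apply: H. Qed.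
Let ev_inj d1 d2 : ev d1 =1 ev d2 -> d1 = d2.
Proof. by move=> E; apply/val_inj/ffunP. Qed.
Let mk_ok (f : V -> V) : (forall u v, f (u + v) = f u + f v) ->
  (forall r v, f (act r v) = act r (f v)) -> endo [ffun v => f v].
Proof. by move=> f1 f2; apply/endoP; split=> *; rewrite !ffunE. Qed.
Let mk (f : V -> V) f1 f2 : D := exist (fun f => is_true (endo f)) _ (@mk_ok f f1 f2).
Let mkE f f1 f2 v : ev (@mk f f1 f2) v = f v. Proof. by rewrite /ev ffunE. Qed.

Let actN r v : act r (- v) = - act r v.
Proof. by apply: (addIr (act r v)); rewrite -actDr !addNr act0. Qed.

Let zeroD : D. Proof. by apply: (@mk (fun=> 0)) => *; rewrite ?addr0 ?act0. Defined.
Let oneD : D. Proof. by apply: (@mk id). Defined.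
Let oppD (d : D) : D.
Proof. by apply: (@mk (fun v => - ev d v)) => *; rewrite ?evD ?opprD ?ev_act ?actN. Defined.
Let addD (d1 d2 : D) : D.
Proof.
by apply: (@mk (fun v => ev d1 v + ev d2 v)) => *; rewrite ?evD 1?addrACA ?ev_act ?actDr.
Defined.
Let mulD (d1 d2 : D) : D.
Proof. by apply: (@mk (fun v => ev d1 (ev d2 v))) => *; rewrite ?evD ?ev_act. Defined.

Let ev0 v : ev zeroD v = 0. Proof. exact: mkE. Qed.
Let ev1 v : ev oneD v = v. Proof. exact: mkE. Qed.
Let evN d v : ev (oppD d) v = - ev d v. Proof. exact: mkE. Qed.
Let evA d1 d2 v : ev (addD d1 d2) v = ev d1 v + ev d2 v. Proof. exact: mkE. Qed.
Let evM d1 d2 v : ev (mulD d1 d2) v = ev d1 (ev d2 v). Proof. exact: mkE. Qed.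

Let d_addA : associative addD. Proof. by move=> x y w; apply: ev_inj => v; rewrite !evA addrA. Qed.
Let d_addC : commutative addD. Proof. by move=> x y; apply: ev_inj => v; rewrite !evA addrC. Qed.
Let d_add0 : left_id zeroD addD.
Proof. by move=> x; apply: ev_inj => v; rewrite !evA ev0 add0r. Qed.
Let d_addN : left_inverse zeroD oppD addD.
Proof. by move=> x; apply: ev_inj => v; rewrite !evA evN ev0 addNr. Qed.
Let d_mulA : associative mulD. Proof. by move=> x y w; apply: ev_inj => v; rewrite !evM. Qed.
Let d_mul1x : left_id oneD mulD. Proof. by move=> x; apply: ev_inj => v; rewrite evM ev1. Qed.
Let d_mulx1 : right_id oneD mulD. Proof. by move=> x; apply: ev_inj => v; rewrite evM ev1. Qed.
Let d_mulDl : left_distributive mulD addD.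
Proof. by move=> x y w; apply: ev_inj => v; rewrite !(evM, evA). Qed.
Let d_mulDr : right_distributive mulD addD.
Proof. by move=> x y w; apply: ev_inj => v; rewrite !(evM, evA) evD. Qed.
Let d_one_neq0 : oneD != zeroD.
Proof. by apply: contraNneq v0_neq0 => /(congr1 (ev^~ v0)); rewrite ev1 ev0 => ->. Qed.
(** Schur: if [x] kills a nonzero [u - v], it kills every [r (u - v)], hence all of [V]. So a
    nonzero [x] is injective, bijective by finiteness, and its inverse again commutes with the
    action. *)
Let d_mulV x : x != zeroD -> exists y, mulD y x = oneD /\ mulD x y = oneD.
Proof.
move=> x0; have xB u v : ev x (u - v) = ev x u - ev x v.
  by apply: (addIr (ev x v)); rewrite -evD !subrK.
have xI : injective (ev x).
  move=> u v uv; apply/eqP; rewrite -subr_eq0; apply: contraNT x0 => w0; apply/eqP/ev_inj => w.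
  have [r <-] := act_irr w w0; by rewrite ev_act ev0 xB uv subrr act0.
have [g xg gx] := injF_bij xI.
have g1 u v : g (u + v) = g u + g v by apply: xI; rewrite evD !gx.
have g2 r v : g (act r v) = act r (g v) by apply: xI; rewrite ev_act !gx.
by exists (mk g1 g2); split; apply: ev_inj => v; rewrite evM mkE ev1 ?xg ?gx.
Qed.

(** [V] becomes a vector space over its own commutant, so the density argument applies with every
    commuting map a scalar by construction. *)
Lemma irreducible_matrix_iso : exists (F : finFieldType) (n : nat), (0 < n)%N /\
  semiring_iso +%R mul (fun A B : 'M[F]_n => A + B) (fun A B : 'M[F]_n => A *m B).
Proof.
have [F [f [g [gK f1 fD fM]]]] := finite_skew_field d_addA d_addC d_add0 d_addN d_mulA
  d_mul1x d_mulx1 d_mulDl d_mulDr d_one_neq0 d_mulV.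
pose sc (a : F) (v : V) : V := ev (f a) v.
have scA a b v : sc a (sc b v) = sc (a * b) v by rewrite /sc fM evM.
have sc1 : left_id 1 sc by move=> v; rewrite /sc f1 ev1.
have scDr : right_distributive sc +%R by move=> a u v; apply: evD.
have scDl v : {morph sc^~ v : a b / a + b} by move=> a b; rewrite /sc fD evA.
pose W : lmodType F :=
  HB.pack (V : Type) (V : zmodType) (GRing.Zmodule_isLmodule.Build F V scA sc1 scDr scDl).
exists F; apply: (@density_matrix_iso R mul F W act (enum V) _ _ _ _ _ _ _ _ v0).
- by move=> v; apply: (mem_enum V).
- exact: actDl.
- exact: actDr.
- exact: actM.
- by move=> r a v; apply/esym/ev_act.
- exact: act_faithful.
- exact: act_irr.
- by move=> h h1 h2; exists (g (mk h1 h2)) => v; rewrite -[RHS]/(ev _ v) gK mkE.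
exact: v0_neq0.
Qed.

End Commutant.

(** * Rings and two-element semirings: simplicity, and the zero multiplication case *)

Lemma card_le2_simple (R : finType) (add mul : R -> R -> R) :
  (#|R| <= 2)%N -> simple_semiring add mul.
Proof.
move=> R2; apply: simple_by_contra => r [rxx rC _ _ _] x y rxy /eqP xy.
have xyT u : (u == x) || (u == y).
  have /eqP xyE : [set x; y] == setT by rewrite eqEcard subsetT cardsT cards2 xy.
  by rewrite -in_set2 xyE inE.
by move=> u v; have [/orP[]/eqP-> /orP[]/eqP->] := (xyT u, xyT v); auto.
Qed.

(** The difference [C] of a congruent pair is congruent to 0. Matrix units on both sides isolate a
    nonzero entry of [C], which makes every multiple of a matrix unit, hence every matrix, congruent
    to 0. *)
Lemma matrix_simple (R : finType) (add mul : R -> R -> R) (F : fieldType) n :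
  semiring_iso add mul (fun A B : 'M[F]_n => A + B) (fun A B : 'M[F]_n => A *m B) ->
  simple_semiring add mul.
Proof.
move=> [phi [[psi phiK psiK] phiM]]; apply: simple_by_contra => r [rxx rC rT rD rM] x y rxy xy.
pose q A B := r (psi A) (psi B).
have psiD A B : psi (A + B) = add (psi A) (psi B).
  by apply: (can_inj phiK); rewrite (proj1 (phiM _ _)) !psiK.
have psiM A B : psi (A *m B) = mul (psi A) (psi B).
  by apply: (can_inj phiK); rewrite (proj2 (phiM _ _)) !psiK.
have qD A B C : q A B -> q (A + C) (B + C) by rewrite /q !psiD; apply: rD.
have qM A B : q A 0 -> q (B *m A) 0 /\ q (A *m B) 0.
  by move=> /(rM _ _ (psi B)); rewrite -!psiM mulmx0 mul0mx.
pose C := phi x - phi y.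
have qC : q C 0 by rewrite -(subrr (phi y)); apply: qD; rewrite /q !phiK.
have [i [j Cij]] : exists i j, C i j != 0.
  have : C != 0 by rewrite subr_eq0 (can_eq phiK); apply/eqP.
  by case/matrix0Pn => i [j Cij]; exists i, j.
have q_delta a k l : q (a *: delta_mx k l) 0.
  have [_ /(qM _ ((a / C i j) *: delta_mx k i))[+ _]] := qM _ (delta_mx j l) qC.
  suff -> : ((a / C i j) *: delta_mx k i) *m (C *m delta_mx j l) = a *: delta_mx k l by [].
  apply/matrixP => u v; rewrite !mxE (bigD1 i) //= big1 ?addr0 => [|w wi]; last first.
    by rewrite !mxE (negPf wi) andbF mulr0 mul0r.
  rewrite !mxE eqxx andbT (bigD1 j) //= big1 ?addr0 => [|w wj]; last first.
    by rewrite !mxE (negPf wj) mulr0.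
  rewrite !mxE eqxx /=; case: (u == k); case: (v == l); rewrite ?(mulr0, mul0r, mulr1) //.
  by move: Cij; rewrite !mxE => Cij; rewrite divfK.
have q0 A : q A 0.
  rewrite (matrix_sum_delta A).
  elim/big_ind: _ => [|B D qB qD0|k _]; first exact: rxx.
    by have := qD _ _ D qB; rewrite add0r => /rT; apply.
  elim/big_ind: _ => [|B D qB qD0|l _]; first exact: rxx.
    by have := qD _ _ D qB; rewrite add0r => /rT; apply.
  exact: q_delta.
move=> u v; rewrite -(phiK u) -(phiK v); apply: rT (q0 _) _; apply: rC; exact: q0.
Qed.

(** The difference of a nontrivial congruent pair generates the additive group, and all its
    multiples are congruent to 0. *)
Lemma prime_order_simple (R : finZmodType) (mul : R -> R -> R) :
  prime #|R| -> simple_semiring +%R mul.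
Proof.
move=> pR; apply: simple_by_contra => r [rxx rC rT rD rM] x y rxy xy.
pose d := x - y; have rd : r d 0 by rewrite -(subrr y); apply: rD.
have dT : <[d]>%g = [set: R].
  apply/eqP; rewrite eqEcard subsetT cardsT -orderE /=.
  have := order_dvdG (in_setT d); rewrite cardsT => /(prime_nt_dvdP pR) -> //.
  by rewrite order_eq1 FinRing.zmod1gE subr_eq0; apply/eqP.
have r0 u : r u 0.
  have /cycleP[n ->] : u \in <[d]>%g by rewrite dT inE.
  rewrite FinRing.zmodXgE; elim: n => [|n IH]; first exact: rxx.
  by have := rD _ _ (d *+ n) rd; rewrite mulrS add0r => /rT; apply.
by move=> u v; apply: rT (r0 u) _; apply: rC.
Qed.

(** By Cauchy there is a subgroup of prime order; as all products vanish, its cosets form a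
    nontrivial congruence, so it is the whole group. *)
Lemma zero_ring_simple_prime (R : finZmodType) (mul : R -> R -> R) :
  (forall x y, mul x y = 0) -> (1 < #|R|)%N -> simple_semiring +%R mul -> prime #|R|.
Proof.
move=> mul0 R1 simp; have pp := pdiv_prime R1.
have [] := @Cauchy _ _ [set: R]%G pp; first by rewrite cardsT pdiv_dvd.
move=> x _ ox; pose q (u v : R) := u - v \in <[x]>%g.
have [qE|qF] : (forall u v, q u v <-> u = v) \/ (forall u v, q u v).
- apply: simp; split=> [u|u v|u v w|u v w|u v w]; rewrite /q.
  + by rewrite subrr -FinRing.zmod1gE group1.
  + by move=> uv; rewrite -opprB -FinRing.zmodVgE groupV.
  + by move=> uv vw; rewrite -(subrKA v) -FinRing.zmodMgE groupM.
  + by rewrite opprD addrACA subrr addr0.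
  by rewrite !mul0 subrr -FinRing.zmod1gE group1.
- have /qE x0 : q x 0 by rewrite /q subr0 cycle_id.
  by move: pp; rewrite -ox x0 -FinRing.zmod1gE order1.
rewrite -(cardsT R); suff -> : [set: R] = <[x]>%g by rewrite -[#|_|]/(#[x]%g) ox.
by apply/setP => u; rewrite inE; have := qF u 0; rewrite /q subr0 => ->.
Qed.

(** * Simple rings with nonzero multiplication *)

Section SimpleRing.
Variables (R : finZmodType) (mul : R -> R -> R).
Hypothesis mA : associative mul.
Hypothesis mDr : forall x y w, mul x (y + w) = mul x y + mul x w.
Hypothesis mDl : forall x y w, mul (x + y) w = mul x w + mul y w.
Hypothesis simp : simple_semiring +%R mul.
Hypothesis mul_neq0 : exists x y, mul x y <> 0.

Let mul0x x : mul 0 x = 0. Proof. by apply: (addIr (mul 0 x)); rewrite -mDl !add0r. Qed.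
Let mulx0 x : mul x 0 = 0. Proof. by apply: (addIr (mul x 0)); rewrite -mDr !add0r. Qed.
Let mulNx x y : mul (- x) y = - mul x y.
Proof. by apply: (addIr (mul x y)); rewrite -mDl !addNr mul0x. Qed.

Let mul_faithful x : (forall r, mul r x = 0) -> x = 0.
Proof.
have [qE|qF] : (forall x y, (forall r, mul r x = mul r y) <-> x = y)
            \/ (forall x y r, mul r x = mul r y).
- apply: simp; split=> // [u v w uv vw r|u v w uv r|u v w uv].
  + by rewrite uv.
  + by rewrite !mDr uv.
  by split=> r; rewrite !mA ?uv // -!mA uv.
- by move=> x0; apply/qE => r; rewrite mulx0.
by have [u [v []]] := mul_neq0; rewrite (qF _ 0) mulx0.
Qed.

Lemma simple_ring_matrix : exists (F : finFieldType) (n : nat), (0 < n)%N /\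
  semiring_iso +%R mul (fun A B : 'M[F]_n => A + B) (fun A B : 'M[F]_n => A *m B).
Proof.
have [y0 y0_neq0] : exists y : R, y != 0.
  by have [x [y xy]] := mul_neq0; exists y; apply: contra_not_neq xy => ->; rewrite mulx0.
have [x0 x0_neq0 x0_min] := exists_minimal_left_ideal mA y0_neq0.
pose P y := [exists r, y == mul r x0].
have Pm r : P (mul r x0) by apply/existsP; exists r.
have PP y : P y -> exists r, y = mul r x0 by move=> /existsP[r /eqP ->]; exists r.
have PD u v : P u -> P v -> P (u + v) by move=> /PP[r ->] /PP[s ->]; rewrite -mDl.
have PN u : P u -> P (- u) by move=> /PP[r ->]; rewrite -mulNx.
have P0 : P 0 by rewrite -(mul0x x0).
have Pact r u : P u -> P (mul r u) by move=> /PP[s ->]; rewrite mA.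
pose T : finType := {y : R | P y}.
pose zeroT : T := exist (fun y => is_true (P y)) 0 P0.
pose oppT (u : T) : T := exist (fun y => is_true (P y)) (- sval u) (PN _ (svalP u)).
pose addT (u v : T) : T :=
  exist (fun y => is_true (P y)) (sval u + sval v) (PD _ _ (svalP u) (svalP v)).
pose actT r (u : T) : T := exist (fun y => is_true (P y)) (mul r (sval u)) (Pact r _ (svalP u)).
have addTA : associative addT by move=> u v w; apply/val_inj/addrA.
have addTC : commutative addT by move=> u v; apply/val_inj/addrC.
have addT0 : left_id zeroT addT by move=> u; apply/val_inj/add0r.
have addTN : left_inverse zeroT oppT addT by move=> u; apply/val_inj/addNr.
pose V : finZmodType := HB.pack T (GRing.isZmodule.Build T addTA addTC addT0 addTN).
pose elt r : V := exist (fun y => is_true (P y)) (mul r x0) (Pm r).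
have [r0 r0P] : exists r, mul r x0 != 0.
  apply/existsP; apply: contraNT x0_neq0 => /existsPn H; apply/eqP/mul_faithful => r.
  by apply/eqP; have := H r; rewrite negbK.
apply: (@irreducible_matrix_iso R V mul actT _ _ _ _ _ (elt r0)).
- by move=> r s v; apply/val_inj/mDl.
- by move=> r u v; apply/val_inj/mDr.
- by move=> r s v; apply/val_inj/esym/mA.
(* Faithfulness: acting alike on [R x0] is a congruence. Were it full, every [r] would kill [r0 x0],
   which would then be 0. *)
- have [qE|qF] : (forall r s, (forall u, mul r (mul u x0) = mul s (mul u x0)) <-> r = s)
              \/ (forall r s u, mul r (mul u x0) = mul s (mul u x0)).
  + apply: simp; split=> // [u v w uv vw r|u v w uv r|u v w uv].
    * by rewrite uv.
    * by rewrite !mDl uv.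
    by split=> r; rewrite -!mA ?uv // (mA w) uv.
  + by move=> r s rs; apply/qE => u; have /(congr1 val) := rs (elt u).
  case/eqP: r0P; apply: mul_faithful => r; by rewrite (qF r 0) mul0x.
- move=> v w v1; have [[r vr] [s ws]] := (PP _ (svalP (v : T)), PP _ (svalP (w : T))).
  have r1 : mul r x0 != 0 by apply: contraNneq v1 => r1; apply/eqP/val_inj; rewrite /= vr.
  have [t st] := x0_min r r1 s; exists t; apply/val_inj; rewrite /= ws st; congr mul; exact: vr.
by apply: contraNneq r0P => /(congr1 val)/eqP.
Qed.
End SimpleRing.

(* The congruence of the archimedean components of the additive monoid is trivial or full. *)
Lemma simple_group_or_idempotent (R : nmodType) (mul : R -> R -> R) :
  (forall x y w, mul x (y + w) = mul x y + mul x w) ->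
  (forall x y w, mul (x + y) w = mul x w + mul y w) ->
  simple_semiring +%R mul ->
  (forall x : R, x + x = x) \/ (forall x : R, exists y, x + y = 0).
Proof.
move=> mDr mDl simp; pose arch (x y : R) := exists n u, x *+ n.+1 = y + u.
have mMr w x n : mul w (x *+ n.+1) = mul w x *+ n.+1.
  by elim: n => // n IH; rewrite mulrS mDr IH -mulrS.
have mMl w x n : mul (x *+ n.+1) w = mul x w *+ n.+1.
  by elim: n => // n IH; rewrite mulrS mDl IH -mulrS.
have archT x y w : arch x y -> arch y w -> arch x w.
  move=> [n [u xy]] [m [v yw]]; exists (n.+1 * m.+1).-1, (v + u *+ m.+1).
  by rewrite prednK // mulrnA xy mulrnDl yw addrA.
have archD x y w : arch x y -> arch (x + w) (y + w).
  by move=> [n [u xy]]; exists n, (u + w *+ n); rewrite mulrnDl xy mulrS addrACA.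
have archMr x y w : arch x y -> arch (mul w x) (mul w y).
  by move=> [n [u xy]]; exists n, (mul w u); rewrite -mMr xy mDr.
have archMl x y w : arch x y -> arch (mul x w) (mul y w).
  by move=> [n [u xy]]; exists n, (mul u w); rewrite -mMl xy mDl.
have [aE|aF] : (forall x y, arch x y /\ arch y x <-> x = y) \/ (forall x y, arch x y /\ arch y x).
- apply: simp; split=> [x|x y []|x y w [xy yx] [yw wy]|x y w [xy yx]|x y w [xy yx]].
  + by split; exists 0%N, 0; rewrite addr0.
  + by [].
  + by split; [apply: archT xy yw|apply: archT wy yx].
  + by split; apply: archD.
  by split; split; [apply: archMr|apply: archMr|apply: archMl|apply: archMl].
(* [x] and [x + x] always lie in the same component; and if 0 lies in the component of [x], then
   [x + u] is a multiple of 0. *)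
- left=> x; apply/aE; split; first by exists 0%N, x.
  by exists 1%N, 0; rewrite addr0 mulr2n.
by right=> x; have [[n [u xu]] _] := aF 0 x; exists u; rewrite -xu mul0rn.
Qed.

Lemma exists_opposite (R : finType) (add : R -> R -> R) (z : R) :
  associative add -> commutative add -> left_id z add -> (forall x, exists y, add x y = z) ->
  exists opp : R -> R, left_inverse z opp add.
Proof.
move=> addA addC add0 addV; exists (fun x => odflt x [pick y | add x y == z]) => x.
case: pickP => [y /eqP|]; first by rewrite /= addC.
by have [y xy] := addV x; move=> /(_ y); rewrite xy eqxx.
Qed.
Local Close Scope ring_scope.

(** * The classification *)

Theorem theorem7p4 (R : finType) (add mul : R -> R -> R) (z : R)
  (Hsr : is_semiring add mul) (Hz : forall x, add z x = x) :
  simple_semiring add mul <->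
  (#|R| <= 2)%N \/
      (exists (F : finFieldType) (n : nat), (0 < n)%N /\
         semiring_iso add mul (fun A B : 'M[F]_n => (A + B)%R)
                              (fun A B : 'M[F]_n => (A *m B)%R)) \/
      [/\ prime #|R|, (forall x, exists y, add x y = z) & (forall x y, mul x y = z)] \/
      (exists (d : Order.disp_t) (L : finTBLatticeType d) (S : {set {ffun L -> L}}),
         [/\ subsemiring is_Res S, iso_to_maps add mul S &
             (forall a b : L, e_map a b \in S)]) \/
      (exists (d : Order.disp_t) (L : finTBLatticeType d) (S : {set {ffun L -> L}}),
         [/\ (2 < #|L|)%N, top_join_irreducible (L := L),
             subsemiring is_Res1 S, iso_to_maps add mul S &
             [/\ (forall a : L, a != \top -> f_map a \bot \in S),
                 (forall f, f \in S -> exists2 a : L, a != \top & fle (f_map a \bot) f) &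
                 (forall a b : L, a != \bot -> a != \top ->
                     exists2 f, f \in S & f a = b)]]) \/
      (exists (d : Order.disp_t) (L : finTBLatticeType d) (S : {set {ffun L -> L}}),
         [/\ (1 < #|L|)%N, subsemiring is_JM S, iso_to_maps add mul S &
             [/\ (forall a : L, k_map a \in S),
                 (forall f, f \in S -> exists a : L, fle (k_map a) f) &
                 (forall a b : L, b != \top -> exists2 f, f \in S &
                     forall x, (x <= a -> f x = b)%O /\ (~~ (x <= a) -> b < f x)%O)]]) \/
      (exists (d : Order.disp_t) (L : finTBLatticeType d) (S : {set {ffun L -> L}}),
         [/\ (1 < #|L|)%N, top_join_irreducible (L := L),
             subsemiring is_JM1 S, iso_to_maps add mul S &
             (forall a b : L, a != \top -> f_map a b \in S) /\
             (forall f, f \in S -> exists a b : L, a != \top /\ fle (f_map a b) f)]).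
Proof.
have [addA addC mulA mulDr mulDl] := Hsr; split=> [simp|].
  have [R2|R2] := leqP #|R| 2; [by left|right].
  pose N : nmodType := HB.pack R (GRing.isNmodule.Build R addA addC Hz).
  have [addxx|addV] := @simple_group_or_idempotent N mul mulDr mulDl simp.
    pose L := semilattice_lattice addA addC addxx Hz.
    have HL : @simple_idempotent _ L mul.
      split; [exact: mulA|exact: mulDr|exact: mulDl|exact: simp|].
      by rewrite (@bij_eq_card L R id) //; exists id.
    do 2 right.
    (* Four cases, according to whether [z] is absorbing from the left and from the right: both,
       left only, right only, neither. *)
    have [/forallP bl|] := boolP [forall r, mul z r == z];
      have [/forallP br|] := boolP [forall r, mul r z == z].
    - left; apply: (simple_idempotent_Res HL) => r; apply/eqP; [exact: br|exact: bl].
    - move=> /forallPn[r /eqP rz]; do 2 right; left.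
      by apply: (simple_idempotent_JM HL) => [|r']; [exists r|apply/eqP/bl].
    - move=> /forallPn[r /eqP rz]; right; left.
      by apply: (simple_idempotent_Res1 HL) => [r'|]; [apply/eqP/br|exists r].
    move=> /forallPn[r /eqP rz] /forallPn[s /eqP sz]; do 3 right.
    by apply: (simple_idempotent_JM1 HL); [exists r|exists s].
  have [opp addN] := exists_opposite addA addC Hz addV.
  pose G : finZmodType := HB.pack R (GRing.isZmodule.Build R addA addC Hz addN).
  have [mul0|mul0] := classic (forall x y, mul x y = z).
    right; left; split=> //; rewrite -(@bij_eq_card G R id); last by exists id.
    apply: (@zero_ring_simple_prime G mul mul0 _ simp).
    by rewrite (@bij_eq_card G R id) ?(ltnW R2) //; exists id.
  left; apply: (@simple_ring_matrix G mul mulA mulDr mulDl simp).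
  have /not_all_ex_not[x /not_all_ex_not[y xy]] := mul0.
  by exists x, y.
case=> [|[[F [n [_ iso]]]|[[pR addV mul0]|[[d [L [S [Ssub Siso Se]]]]|
  [[d [L [S [L2 irr Ssub Siso [S1 _ S3]]]]]|
  [[d [L [S [_ Ssub Siso [S1 _ S3]]]]]|[d [L [S [_ _ Ssub Siso [S1 S2]]]]]]]]]]].
- exact: card_le2_simple.
- exact: matrix_simple iso.
- have [opp addN] := exists_opposite addA addC Hz addV.
  pose G : finZmodType := HB.pack R (GRing.isZmodule.Build R addA addC Hz addN).
  apply: (@prime_order_simple G mul).
  by rewrite (@bij_eq_card G R id) //; exists id.
- exact: simple_Res Ssub Siso Se.
- exact: simple_Res1 L2 irr Ssub Siso S1 S3.
- exact: simple_JM Ssub Siso S1 S3.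
exact: simple_JM1 Ssub Siso S1 S2.
Qed.
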